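(* Let $n\ge 1$ and suppose $\phi:\mathbb{R}^n\to(0,\infty)$ satisfies the following conditions: (1) $\phi$ is a radial, radially decreasing measurable function with $\|\phi\|_1=\int_{\mathbb{R}^n}\phi(x)\,dx=1$; (2) $\displaystyle \sup\left\{\frac{\phi_t(x)}{\phi(x)} : t\in(0,1),\ \|x\|>1\right\}<\infty$; (3) for all $y\in\mathbb{R}$, $\displaystyle \int_{\mathbb{R}^n}\phi(x)\,\|x\|^{iy}\,dx\neq 0$. Suppose $\mu$ is a positive Radon measure on $\mathbb{R}^n$ such that $\mu\ast\phi_{t_0}(0)$ is finite for some $t_0\in(0,\infty)$. If for some $x_0\in\mathbb{R}^n$ and $L\in[0,\infty)$ $$\lim_{t\to 0}\mu\ast\phi_t(x_0)=L,$$ then $D_{sym}\mu(x_0)=L$ (that is, the symmetric derivative exists at $x_0$ and equals $L$).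
   Context: $m$ (also written $dx$) is Lebesgue measure on $\mathbb{R}^n$, $\|\cdot\|$ is the Euclidean norm, and $B(x,r)$ is the Euclidean ball with center $x$ and radius $r$. A positive Radon measure is a nonnegative Borel measure on $\mathbb{R}^n$ that is finite on compact sets. A function $\phi$ is radial if $\phi(x)$ depends only on $\|x\|$, and radially decreasing if $\phi(x)\ge\phi(y)$ whenever $\|x\|\le\|y\|$. For $t>0$, $\phi_t(x)=t^{-n}\phi(x/t)$, and $\mu\ast\phi_t(x)=\int_{\mathbb{R}^n}\phi_t(x-\xi)\,d\mu(\xi)$. (For nonnegative radially decreasing $\phi$, finiteness of $\mu\ast\phi_{t_0}(0)$ implies finiteness of $\mu\ast\phi_t(x)$ for all $t\in(0,t_0)$ and all $x\in\mathbb{R}^n$.) The symmetric derivative of $\mu$ at $x_0$ is $D_{sym}\mu(x_0)=\lim_{r\to 0}\frac{\mu(B(x_0,r))}{m(B(x_0,r))}$, provided the limit exists. *)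

(* Defs.v *)
From HB Require Import structures.
From mathcomp Require Import all_boot all_order all_algebra.
From mathcomp Require Import all_classical all_reals all_analysis.
From mathcomp Require Import measurable_realfun.
From mathcomp Require Import complex.

Set Implicit Arguments.
Unset Strict Implicit.
Unset Printing Implicit Defensive.

Import Order.TTheory GRing.Theory Num.Theory.
Import numFieldNormedType.Exports.

Local Open Scope classical_set_scope.
Local Open Scope ring_scope.
Local Open Scope complex_scope.

(* Matrices, hence row vectors 'rV[R]_n = R^n, carry the Borel sigma-algebra of
   the library's topology. *)
Section borel_matrix.
Context (R : realType) (m n : nat).
Let borel := g_sigma_algebraType (@open 'M[R]_(m, n)).

HB.instance Definition _ := @isMeasurable.Build
  (sigma_display (@open 'M[R]_(m, n))) 'M[R]_(m, n)
  (@measurable _ borel) measurable0 (@measurableC _ borel)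
  (@bigcupT_measurable _ borel).
End borel_matrix.

Lemma measurable_coord (R : realType) n (i : 'I_n) :
  measurable_fun setT (fun v : 'rV[R]_n => v ord0 i).
Proof.
apply: (measurability (@RGenOpens.G R)); first exact: RGenOpens.measurableE.
move=> _ [_ [a [b ->] <-]]; rewrite setTI.
apply: sub_sigma_algebra; apply: open_comp; last exact: interval_open.
by move=> v _; exact: coord_continuous.
Qed.

Lemma measurable_fun_row d (T : measurableType d) (R : realType) n
    (f : T -> 'rV[R]_n) :
  (forall i, measurable_fun setT (fun x => f x ord0 i)) ->
  measurable_fun setT f.
Proof.
move=> mf.
apply: (measurability (@open 'rV[R]_n)) => // _ [U oU <-]; rewrite setTI.
pose good (q : 'rV[rat]_n * nat) :=
  ball (map_mx ratr q.1 : 'rV[R]_n) q.2.+1%:R^-1 `<=` U.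
have mball (c : 'rV[R]_n) (e : R) : 0 < e -> measurable (f @^-1` ball c e).
  move=> e0.
  have -> : f @^-1` ball c e =
      \bigcap_(i in [set: 'I_n]) ((fun x => f x ord0 i) @^-1` ball (c ord0 i) e).
    apply/seteqP; split=> x /=.
      by move=> [_ h] i _; exact: h.
    by move=> h; split=> // i j; rewrite (ord1 i); exact: h.
  apply: fin_bigcap_measurable => // i _.
  rewrite -[X in measurable X]setTI; apply: mf => //.
  by rewrite ball_itv; exact: measurable_itv.
have -> : f @^-1` U = \bigcup_q (if `[< good q >] then
    f @^-1` ball (map_mx ratr q.1 : 'rV[R]_n) q.2.+1%:R^-1 else set0).
  apply/seteqP; split=> x /=; last first.
    by move=> [q _]; case: asboolP => // gq /gq.
  move=> Ufx; have /nbhs_ballP[e /= e0 eU] : nbhs (f x) U by exact: open_nbhs_nbhs.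
  have e20 : 0 < e / 2 by rewrite divr_gt0.
  have [k ke] : exists k : nat, k.+1%:R^-1 < e / 2.
    have [k _ /(_ k (leqnn k))] := near_infty_natSinv_lt (PosNum e20).
    by exists k.
  have k0 : 0 < k.+1%:R^-1 :> R by rewrite invr_gt0.
  have hq (i : 'I_n) :
    {q : rat | ball (f x ord0 i) (k.+1%:R^-1 : R) (ratr q : R)}.
    apply: cid.
    have lt1 : f x ord0 i - k.+1%:R^-1 < f x ord0 i + k.+1%:R^-1.
      by rewrite ltrD2l gtrN.
    have [q] := rat_in_itvoo lt1.
    by exists q; rewrite ball_itv.
  pose q : 'rV[rat]_n := \row_i sval (hq i).
  have bq : ball (map_mx ratr q : 'rV[R]_n) k.+1%:R^-1 (f x).
    split=> // i j; rewrite (ord1 i) !mxE; apply: ball_sym.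
    exact: svalP (hq j).
  exists (q, k) => //=; case: asboolP => // -[] y /= qy; apply: eU.
  rewrite (splitr e); apply: (@ball_triangle _ _ (map_mx ratr q : 'rV[R]_n)).
    by apply: ball_sym; exact: le_ball (ltW ke) _ bq.
  exact: le_ball (ltW ke) _ qy.
apply: countable_bigcupT_measurable => // q; case: ifP => // _; apply: mball.
by rewrite invr_gt0.
Qed.

Section lebesgue_measure_rV.
Context {R : realType}.

Section step.
Variable n : nat.

Definition cons_rV (p : measurableTypeR R * 'rV[R]_n) : 'rV[R]_n.+1 :=
  \row_i if unlift ord0 i is Some j then p.2 ord0 j else p.1.

Definition tail_rV (v : 'rV[R]_n.+1) : 'rV[R]_n := \row_i v ord0 (lift ord0 i).

Lemma cons_rV0 p : cons_rV p ord0 ord0 = p.1.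
Proof. by rewrite mxE unlift_none. Qed.

Lemma cons_rVS p i : cons_rV p ord0 (lift ord0 i) = p.2 ord0 i.
Proof. by rewrite mxE liftK. Qed.

Lemma cons_rVK (v : 'rV[R]_n.+1) : cons_rV (v ord0 ord0, tail_rV v) = v.
Proof.
apply/rowP => i; case: (unliftP ord0 i) => [j|] ->; first by rewrite cons_rVS mxE.
by rewrite cons_rV0.
Qed.

Lemma measurable_cons_rV : measurable_fun setT cons_rV.
Proof.
apply: measurable_fun_row => i; case: (unliftP ord0 i) => [j|] ->.
  under eq_fun do rewrite cons_rVS.
  exact: measurableT_comp (measurable_coord _) measurable_snd.
by under eq_fun do rewrite cons_rV0; exact: measurable_fst.
Qed.

Lemma measurable_tail_rV : measurable_fun setT tail_rV.
Proof.
apply: measurable_fun_row => i; under eq_fun do rewrite mxE.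
exact: measurable_coord.
Qed.

Variable m : {sigma_finite_measure set 'rV[R]_n -> \bar R}.

Definition lebesgue_rV_step : set 'rV[R]_n.+1 -> \bar R :=
  pushforward (@lebesgue_measure R \x m)%E cons_rV.

Let step0 : lebesgue_rV_step set0 = 0%E.
Proof. by rewrite /lebesgue_rV_step /pushforward preimage_set0 measure0. Qed.

Let step_ge0 A : (0 <= lebesgue_rV_step A)%E.
Proof. by rewrite /lebesgue_rV_step /pushforward measure_ge0. Qed.

Let mstep A : measurable A -> measurable (cons_rV @^-1` A).
Proof.
by move=> mA; rewrite -[X in measurable X]setTI; exact: measurable_cons_rV.
Qed.

Let step_sigma_additive : semi_sigma_additive lebesgue_rV_step.
Proof.
move=> F mF tF mUF; rewrite /lebesgue_rV_step /pushforward preimage_bigcup.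
apply: measure_semi_sigma_additive.
- by move=> i; exact: mstep.
- apply/trivIsetP => /= i j _ _ ij; rewrite -preimage_setI.
  by move/trivIsetP : tF => /(_ _ _ _ _ ij) ->//; rewrite preimage_set0.
- by rewrite -preimage_bigcup; exact: mstep.
Qed.

HB.instance Definition _ := isMeasure.Build _ _ _ lebesgue_rV_step
  step0 step_ge0 step_sigma_additive.

Let step_sigma_finite : sigma_finite setT lebesgue_rV_step.
Proof.
have [F TF Foo] : sigma_finite setT (@lebesgue_measure R \x m)%E.
  have /sigma_finiteP[F [TF ndF Foo]] := sigma_finiteT (@lebesgue_measure R).
  have /sigma_finiteP[G [TG ndG Goo]] := sigma_finiteT m.
  exists (fun k => F k `*` G k).
    rewrite -setXTT TF TG predeqE => -[x y]; split.
      move=> [/= [i _ Fx] [j _ Gy]]; exists (maxn i j) => //; split.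
      - by move: x Fx; exact/subsetPset/ndF/leq_maxl.
      - by move: y Gy; exact/subsetPset/ndG/leq_maxr.
    by move=> [k _ []/= ? ?]; split; exists k.
  move=> k; have [? ?] := Foo k; have [? ?] := Goo k.
  split; first exact: measurableX.
  by rewrite product_measure1E// lte_mul_pinfty// ge0_fin_numE.
pose uncons (v : 'rV[R]_n.+1) : measurableTypeR R * 'rV[R]_n :=
  (v ord0 ord0, tail_rV v).
have muncons : measurable_fun setT uncons.
  apply: measurable_fun_pair; first exact: measurable_coord.
  exact: measurable_tail_rV.
have consK p : uncons (cons_rV p) = p.
  case: p => x v; rewrite /uncons cons_rV0; congr pair.
  by apply/rowP => i; rewrite mxE cons_rVS.
exists (fun k => uncons @^-1` F k).
  by rewrite -preimage_bigcup -TF preimage_setT.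
move=> k; have [mF Fk] := Foo k; split.
  by rewrite -[X in measurable X]setTI; exact: muncons.
rewrite /lebesgue_rV_step /pushforward -comp_preimage.
by rewrite (_ : _ \o _ = idfun) ?preimage_id//; apply/funext => p /=.
Qed.

HB.instance Definition _ := Measure_isSigmaFinite.Build _ _ _ lebesgue_rV_step
  step_sigma_finite.
End step.

(* Lebesgue measure on the Borel sets of R^n, as the n-fold product of the
   one-dimensional one; lebesgue_rV_box gives its value on boxes. *)
Fixpoint lebesgue_rV n : {sigma_finite_measure set 'rV[R]_n -> \bar R} :=
  if n is n'.+1 then lebesgue_rV_step (lebesgue_rV n') else \d_(0 : 'rV[R]_0).

Lemma lebesgue_rV_box n (a b : 'rV[R]_n) : (forall i, a ord0 i <= b ord0 i) ->
  lebesgue_rV n [set v | forall i, v ord0 i \in `[a ord0 i, b ord0 i]] =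
  (\prod_(i < n) (b ord0 i - a ord0 i))%:E.
Proof.
elim: n a b => [|n IH] a b ab.
  rewrite big_ord0 /= diracE mem_set//; first by case.
rewrite big_ord_recl EFinM /=.
have abt i : tail_rV a ord0 i <= tail_rV b ord0 i by rewrite !mxE.
have -> : \prod_(i < n) (b ord0 (lift ord0 i) - a ord0 (lift ord0 i)) =
    \prod_(i < n) (tail_rV b ord0 i - tail_rV a ord0 i).
  by apply: eq_bigr => i _; rewrite !mxE.
rewrite -IH//.
set B := (X in lebesgue_rV n X).
have mB : measurable B.
  have -> : B = \bigcap_(i in [set: 'I_n])
      ((fun v : 'rV[R]_n => v ord0 i) @^-1` `[tail_rV a ord0 i, tail_rV b ord0 i]).
    by apply/seteqP; split=> v /= h i => [_|]; exact: h.
  apply: fin_bigcap_measurable => // i _.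
  by rewrite -[X in measurable X]setTI; exact: measurable_coord.
have mI : measurable (`[a ord0 ord0, b ord0 ord0]%classic : set (measurableTypeR R)).
  exact: measurable_itv.
have -> : (b ord0 ord0 - a ord0 ord0)%:E =
    lebesgue_measure (`[a ord0 ord0, b ord0 ord0]%classic : set (measurableTypeR R)).
  rewrite lebesgue_measure_itv /= lte_fin; case: ltP => //.
  by move=> ba; rewrite (le_anti (introT andP (conj ba (ab ord0)))) subrr.
rewrite -product_measure1E//; congr (product_measure1 _ _ _).
apply/seteqP; split=> -[x v] /=.
  move=> h; split; first by have := h ord0; rewrite cons_rV0.
  by move=> i; have := h (lift ord0 i); rewrite cons_rVS !mxE.
move=> [hx hv] i; case: (unliftP ord0 i) => [j|] ->; last by rewrite cons_rV0.
by have := hv j; rewrite cons_rVS !mxE.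
Qed.

End lebesgue_measure_rV.

Section euclidean.
Context {R : realType} {n : nat}.
Implicit Types (x y : 'rV[R]_n) (r : R).

(* The library's norm on 'rV[R]_n is the sup norm, which induces the same
   topology. *)
Definition enorm x : R := Num.sqrt (\sum_(i < n) x ord0 i ^+ 2).

Definition eball x r : set 'rV[R]_n := [set y | enorm (y - x) < r].

Definition radial (phi : 'rV[R]_n -> R) : Prop :=
  forall x y, enorm x = enorm y -> phi x = phi y.

Definition radially_decreasing (phi : 'rV[R]_n -> R) : Prop :=
  forall x y, enorm x <= enorm y -> phi y <= phi x.

Definition dilate (phi : 'rV[R]_n -> R) (t : R) : 'rV[R]_n -> R :=
  fun x => t ^- n * phi (t^-1 *: x).

Variable mu : {measure set 'rV[R]_n -> \bar R}.

Definition radon : Prop :=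
  forall K : set 'rV[R]_n, compact K -> (mu K < +oo)%E.

Definition convolution (f : 'rV[R]_n -> R) x : \bar R :=
  (\int[mu]_xi (f (x - xi))%:E)%E.

Definition has_symmetric_derivative x (l : \bar R) : Prop :=
  (mu (eball x r) / lebesgue_rV n (eball x r))%E @[r --> 0^'+] --> l.

End euclidean.

Section complex_valued.
Context {R : realType}.

Definition expC (z : R[i]) : R[i] :=
  (expR (complex.Re z) * cos (complex.Im z)) +i*
  (expR (complex.Re z) * sin (complex.Im z)).

(* r ^ z for r > 0; since ln 0 = 0 in the library, the value at r = 0 is 1. *)
Definition cpower (r : R) (z : R[i]) : R[i] := expC ((ln r)%:C * z).

(* Meaningful when the real and imaginary parts of f are integrable. *)
Definition complex_integral d (T : measurableType d)
    (mu : {measure set T -> \bar R}) (f : T -> R[i]) : R[i] :=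
  (\int[mu]_x complex.Re (f x)) +i* (\int[mu]_x complex.Im (f x)).

End complex_valued.

(* Main.v *)
(** With f(x) = e^(nx) mu(B(x0, e^(-x))), N(x) = mu * phi_(e^(-x))(x0) and
    g(w) = phi(e^w) n V e^(nw), where V is the volume of the unit ball, polar
    coordinates turn hypothesis (1) into "g is a probability density", (3) into
    "the Fourier transform of g has no zero", and both f and N into additive
    convolutions of the law of ln |z - x0| under mu. Hence f * g is n V times
    the convolution of N with the exponential on a half-line, and tends to V L
    at infinity. Hypothesis (2) lets one discard the part of mu far from x0, so
    that mu may be assumed finite.

    It remains to deduce f -> V L, by Wiener's theorem. Let h = f - V L, so that
    h * g -> 0. For a frequency y, consider H = (h e^(iy.)) * F_d with F_d the
    Fejer kernel of small bandwidth d: H is reproduced by a de la Vallee-Poussin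
    kernel, so it hardly varies at the scale of g, and H times the nonzero
    number g^(y) is close to H * (g e^(iy.)), which tends to 0. This improves an
    asymptotic bound m on H to 3/4 m, so H -> 0. A Fejer kernel of bandwidth N d
    is a trigonometric polynomial times F_d, whence h * F_Lam -> 0 for all Lam.
    Since f(x + u) <= e^(nu) f(x) for u >= 0 and F_Lam concentrates at 0 as Lam
    grows, h -> 0. *)

Require Import Defs.
From HB Require Import structures.
From mathcomp Require Import all_boot all_order all_algebra.
From mathcomp Require Import all_classical all_reals all_analysis.
From mathcomp Require Import measurable_realfun complex ring lra.

Set Implicit Arguments.
Unset Strict Implicit.
Unset Printing Implicit Defensive.

Import Order.TTheory GRing.Theory Num.Theory.
Import numFieldNormedType.Exports.

Local Open Scope classical_set_scope.
Local Open Scope ring_scope.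

(** * Integration of real-valued functions *)

(** Limits are known only at +oo, whereas a convolution sees the whole line. Two devices deal with
    this. Once [mu] is replaced by a finite measure, N(x) is at most a constant times e^(nx), hence
    bounded on every left half-line, so dominated convergence applies to convolutions. And a bound m
    on H that holds only eventually is used as m + e, where e is the excess: it tends to 0 and stays
    negligible under convolution with an integrable kernel.

    All facts about the Fejer kernel come from (1 - cos u) / u^2 and scaling, without Fourier
    inversion: a modulated Fejer kernel is a combination of dilated ones, and the kernel is a
    superposition of cosines of frequency at most d, each fixed by the de la Vallee-Poussin kernel.

    One d must serve every frequency in [0, Lam]. It exists because |g^|^2 has a positive minimum
    there, while the oscillation of H at the scale of g tends to 0 with d. The factor 3/4 is 1/2 for
    that oscillation plus 1/4 for the vanishing errors. Complex functions are carried as pairs of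
    real ones. *)

Section real_integration.
Context d (T : measurableType d) (R : realType).
Variable m : {measure set T -> \bar R}.

Definition L1 (f : T -> R) := m.-integrable setT (EFin \o f).

Lemma L1_meas f : L1 f -> measurable_fun setT f.
Proof. by move=> /measurable_int /measurable_EFinP. Qed.

Lemma L1_le (f g : T -> R) : measurable_fun setT f -> L1 g ->
  (forall x, `|f x| <= g x) -> L1 f.
Proof.
move=> mf ig fg; apply: (le_integrable measurableT _ _ ig).
  exact/measurable_EFinP.
by move=> x _ /=; rewrite lee_fin (le_trans (fg x))// ler_norm.
Qed.

Lemma L1_abs f : L1 f -> L1 (fun x => `|f x|).
Proof. by move=> /integrable_abse; apply: eq_integrable. Qed.

Lemma L1_D (f g : T -> R) : L1 f -> L1 g -> L1 (fun x => f x + g x).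
Proof. by move=> f1 g1; have := integrableD measurableT f1 g1; apply: eq_integrable. Qed.

Lemma L1_B (f g : T -> R) : L1 f -> L1 g -> L1 (fun x => f x - g x).
Proof. by move=> f1 g1; have := integrableB measurableT f1 g1; apply: eq_integrable. Qed.

Lemma L1_Z (f : T -> R) (a : R) : L1 f -> L1 (fun x => a * f x).
Proof. by move=> f1; have := integrableZl measurableT a f1; apply: eq_integrable. Qed.

Lemma L1_bounded_mul (f k : T -> R) (M : R) : measurable_fun setT f ->
  (forall x, `|f x| <= M) -> L1 k -> L1 (fun x => f x * k x).
Proof.
move=> mf fM k1; apply: (@L1_le _ (fun x => M * `|k x|)).
- by apply: measurable_funM => //; exact: L1_meas.
- exact/L1_Z/L1_abs.
- by move=> x; rewrite normrM ler_wpM2r.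
Qed.

Lemma Rint0 : \int[m]_x (0 : R) = 0.
Proof. by rewrite /Rintegral integral0. Qed.

Lemma RintZl (f : T -> R) (a : R) : L1 f ->
  \int[m]_x (a * f x) = a * \int[m]_x f x.
Proof. exact: RintegralZl. Qed.

Lemma RintD (f g : T -> R) : L1 f -> L1 g ->
  \int[m]_x (f x + g x) = \int[m]_x f x + \int[m]_x g x.
Proof. exact: RintegralD. Qed.

Lemma RintB (f g : T -> R) : L1 f -> L1 g ->
  \int[m]_x (f x - g x) = \int[m]_x f x - \int[m]_x g x.
Proof. exact: RintegralB. Qed.

Lemma Rint_le (f g : T -> R) : measurable_fun setT f -> L1 g ->
  (forall x, `|f x| <= g x) -> `|\int[m]_x f x| <= \int[m]_x g x.
Proof.
move=> mf g1 fg; have f1 := L1_le mf g1 fg.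
apply: (le_trans (le_normr_Rintegral measurableT f1)).
by apply: le_Rintegral => //; exact: L1_abs.
Qed.

Lemma Rint_bound (f k : T -> R) (M : R) : measurable_fun setT f ->
  (forall x, `|f x| <= M) -> L1 k ->
  `|\int[m]_x (f x * k x)| <= M * \int[m]_x `|k x|.
Proof.
move=> mf fM k1; rewrite -RintegralZl//; last exact: L1_abs.
apply: Rint_le.
- by apply: measurable_funM => //; exact: L1_meas.
- exact/L1_Z/L1_abs.
- by move=> x; rewrite normrM ler_wpM2r.
Qed.

Lemma L1_EFin (f : T -> R) : L1 f ->
  ((\int[m]_x f x)%:E = \int[m]_x (f x)%:E)%E.
Proof.
by move=> f1; rewrite /Rintegral fineK//; exact: integrable_fin_num f1.
Qed.

Lemma dct_seq (F : nat -> T -> R) (G g : T -> R) :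
  (forall n, measurable_fun setT (F n)) -> measurable_fun setT G -> L1 g ->
  (forall n x, `|F n x| <= g x) ->
  (forall x, F n x @[n --> \oo] --> G x) ->
  \int[m]_x F n x @[n --> \oo] --> \int[m]_x G x.
Proof.
move=> mF mG g1 Fg FG.
have mFE n : measurable_fun setT (EFin \o F n) by exact/measurable_EFinP.
have mGE : measurable_fun setT (EFin \o G) by exact/measurable_EFinP.
have FGE : {ae m, forall x, setT x -> (F n x)%:E @[n --> \oo] --> (G x)%:E}.
  by apply: aeW => x _; apply: cvg_EFin; [exact: nearW|exact: FG].
have FgE : {ae m, forall x n, setT x -> (`|(F n x)%:E| <= (g x)%:E)%E}.
  by apply: aeW => x n _ /=; rewrite lee_fin.
have [G1 _ h] := dominated_convergence measurableT mFE mGE FGE g1 FgE.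
by apply: fine_cvg; rewrite L1_EFin.
Qed.

End real_integration.

(** * Fubini's theorem for real-valued integrals *)

Section real_fubini.
Local Open Scope ereal_scope.
Context d1 d2 (T1 : measurableType d1) (T2 : measurableType d2) (R : realType).
Variable m1 : {sigma_finite_measure set T1 -> \bar R}.
Variable m2 : {sigma_finite_measure set T2 -> \bar R}.

(** The extended integral is a difference of two Tonelli integrals, measurable whatever the
    integrability of the slices, and [fine] preserves measurability. *)
Lemma measurable_Rint (F : T1 * T2 -> R) : measurable_fun setT F ->
  measurable_fun setT (fun x => \int[m2]_y F (x, y))%R.
Proof.
move=> mF; apply: measurableT_comp => //=.
have mE : measurable_fun setT (EFin \o F) by exact/measurable_EFinP.
under eq_fun do rewrite integralE.
apply: emeasurable_funB.
- rewrite (_ : (fun x => _) = fubini_F m2 (EFin \o F)^\+).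
    by apply: measurable_fun_fubini_tonelli_F => //; exact: measurable_funepos.
  by apply/funext => x; apply: eq_integral => y _; rewrite !funeposE.
- rewrite (_ : (fun x => _) = fubini_F m2 (EFin \o F)^\-).
    by apply: measurable_fun_fubini_tonelli_F => //; exact: measurable_funeneg.
  by apply/funext => x; apply: eq_integral => y _; rewrite !funenegE.
Qed.

(** Slices are integrable at every point, so the real inner integrals agree everywhere with the
    extended ones; the majorant [K] supplies integrability on the product. *)
Lemma Rfubini (F : T1 * T2 -> R) (K : T2 -> R) : measurable_fun setT F ->
  (forall x, L1 m2 (fun y => F (x, y))) ->
  (forall y, L1 m1 (fun x => F (x, y))) ->
  (forall y, \int[m1]_x `|F (x, y)| <= K y)%R ->
  L1 m2 K ->
  [/\ L1 m1 (fun x => \int[m2]_y F (x, y))%R,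
      L1 m2 (fun y => \int[m1]_x F (x, y))%R &
  (\int[m1]_x \int[m2]_y F (x, y) = \int[m2]_y \int[m1]_x F (x, y))%R].
Proof.
move=> mF F1 F2 FK K1.
have mE : measurable_fun setT (EFin \o F) by exact/measurable_EFinP.
have iF : (m1 \x m2).-integrable setT (EFin \o F).
  apply/integrable21ltyP => //.
  have /integrableP[_] := K1; apply: le_lt_trans; apply: ge0_le_integral => //.
  - by move=> y _; exact: integral_ge0.
  - apply: (measurable_fun_fubini_tonelli_G (fun z => `|(EFin \o F) z|)) => //.
    exact: measurableT_comp.
  - apply: measurableT_comp => //; apply/measurable_EFinP; exact: L1_meas K1.
  move=> y _ /=; apply: (@le_trans _ _ (\int[m1]_x `|F (x, y)|%R)%:E).
    by rewrite L1_EFin//; exact: L1_abs.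
  by rewrite lee_fin (le_trans (FK y))// ler_norm.
have E1 : (fun x => (\int[m2]_y F (x, y))%R%:E) = fubini_F m2 (EFin \o F).
  by apply/funext => x; rewrite L1_EFin.
have E2 : (fun y => (\int[m1]_x F (x, y))%R%:E) = fubini_G m1 (EFin \o F).
  by apply/funext => x; rewrite L1_EFin.
have i1 : L1 m1 (fun x => \int[m2]_y F (x, y))%R.
  by rewrite /L1 /comp E1; exact: integrable_fubini_F.
have i2 : L1 m2 (fun y => \int[m1]_x F (x, y))%R.
  apply: L1_le K1 _; last first.
    by move=> y; apply: le_trans (FK y); exact: (le_normr_Rintegral measurableT (F2 y)).
  by apply/measurable_EFinP; rewrite /comp E2; exact: (measurable_fubini_G iF).
split => //; apply: EFin_inj; rewrite !L1_EFin// E1 E2.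
by rewrite integral12_prod_meas1// integral21_prod_meas1.
Qed.

End real_fubini.

Definition image_measure d d' (T1 : measurableType d) (T2 : measurableType d')
    (R : realType) (m : {measure set T1 -> \bar R}) (f : T1 -> T2)
    (mf : measurable_fun setT f) : {measure set T2 -> \bar R} :=
  measure_function_pushforward__canonical__measure_function_Measure m mf.

(** * Affine change of variable on the line *)

Section affine_change_of_variable.
Context (R : realType).
Notation mu := (@lebesgue_measure R).

Lemma measurable_affine (a b : R) : measurable_fun [set: R] (fun x : R => a * x + b).
Proof. by apply: measurable_funD => //; exact: measurable_funM. Qed.

(** Half-open intervals determine the measure. For negative [a] the preimage of such an interval is
    half-open on the other side. *)
Lemma lebesgue_measure_affine (a b : R) (A : set (measurableTypeR R)) :
  a != 0 -> measurable A ->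
  (mu A = `|a|%:E * mu ((fun x : R => a * x + b)%R @^-1` A))%E.
Proof.
move=> a0.
have -> : (`|a|%:E * mu ((fun x : R => (a * x + b)%R) @^-1` A))%E =
    mscale (NngNum (normr_ge0 a)) (@image_measure _ _ (measurableTypeR R)
      (measurableTypeR R) R mu _ (measurable_affine a b)) A by [].
move: A; apply: lebesgue_measure_unique => _ [[u v] _ <-].
rewrite -[RHS]/(`|a|%:E * mu ((fun x : R => (a * x + b)%R) @^-1` `]u, v]))%E.
rewrite lebesgue_measure_itv /= lte_fin.
have [a_lt0|a_gt0|/eqP] := ltgtP a 0; last by rewrite (negbTE a0).
- have -> : (fun x => a * x + b) @^-1` `]u, v] = `[(v - b) / a, (u - b) / a[%classic.
    apply/seteqP; split => x /=; rewrite !in_itv /= ler_ndivrMr// ltr_ndivlMr//;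
    by rewrite lerBrDr ltrBlDr [a * x]mulrC andbC.
  rewrite lebesgue_measure_itv /= lte_fin ltr_ndivrMr// divfK// ltrD2r.
  case: ifP => uv; last by rewrite mule0.
  by rewrite -EFinD -EFinM ltr0_norm//; congr EFin; field.
- have -> : (fun x => a * x + b) @^-1` `]u, v] = `](u - b) / a, (v - b) / a]%classic.
    apply/seteqP; split => x /=; rewrite !in_itv /= ler_pdivlMr// ltr_pdivrMr//;
    by rewrite lerBrDr ltrBlDr [a * x]mulrC.
  rewrite lebesgue_measure_itv /= lte_fin ltr_pdivrMr// divfK// ltrD2r.
  case: ifP => uv; last by rewrite mule0.
  by rewrite -EFinD -EFinM gtr0_norm//; congr EFin; field.
Qed.

Lemma ge0_integral_affine (a b : R) (f : R -> \bar R) : a != 0 ->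
  measurable_fun setT f -> (forall x, 0 <= f x)%E ->
  (\int[mu]_x f x = `|a|%:E * \int[mu]_x f (a * x + b)%R)%E.
Proof.
move=> a0 mf f0.
rewrite (eq_measure_integral (mscale (NngNum (normr_ge0 a))
  (@image_measure _ _ (measurableTypeR R) (measurableTypeR R) R mu _
    (measurable_affine a b)))); last first.
  by move=> A mA _; exact: lebesgue_measure_affine.
rewrite ge0_integral_mscale//; congr (_ * _)%E.
have := @ge0_integral_pushforward _ _ (measurableTypeR R) (measurableTypeR R) R
  _ (measurable_affine a b) mu setT f measurableT mf (fun y _ => f0 y).
by rewrite preimage_setT.
Qed.

Lemma L1_affine (a b : R) (f : R -> R) : a != 0 -> L1 mu f ->
  L1 mu (fun x => f (a * x + b)).
Proof.
move=> a0 f1.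
have mf : measurable_fun [set: R] (fun x => f (a * x + b)).
  by apply: measurableT_comp (L1_meas f1) (measurable_affine a b).
apply/integrableP; split; first exact/measurable_EFinP.
have /integrableP[mE] := f1.
rewrite (ge0_integral_affine b a0)//; last exact: measurableT_comp.
rewrite !ltey; apply: contra => /eqP; rewrite /comp => ->.
by rewrite mulry gtr0_sg ?normr_gt0// mul1e.
Qed.

Lemma Rintegral_affine (a b : R) (f : R -> R) : a != 0 -> L1 mu f ->
  \int[mu]_x f x = `|a| * \int[mu]_x f (a * x + b).
Proof.
move=> a0 f1; have fa1 := L1_affine b a0 f1.
have [mf mfa] := (L1_meas f1, L1_meas fa1).
apply: EFin_inj; rewrite EFinM (L1_EFin f1) (L1_EFin fa1).
rewrite [in LHS]integralE [in RHS]integralE.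
rewrite (ge0_integral_affine b a0 (f := (EFin \o f)^\+)%E)//; last first.
  exact/measurable_funepos/measurable_EFinP.
rewrite (ge0_integral_affine b a0 (f := (EFin \o f)^\-)%E)//; last first.
  exact/measurable_funeneg/measurable_EFinP.
rewrite [in RHS]muleBr//; last exact: (integrable_add_def measurableT fa1).
congr (_ * _ - _ * _)%E; apply: eq_integral => x _.
  by rewrite !funeposE.
by rewrite !funenegE.
Qed.

End affine_change_of_variable.

(** * Convolution on the line *)

Section convolution_on_the_line.
Context (R : realType).
Notation mu := (@lebesgue_measure R).
Implicit Types (f k : R -> R).

Definition conv f k (x : R) : R := \int[mu]_v (f (x - v) * k v).

(** Bounded at every point rather than almost everywhere, so that convolution with an [L1] kernel is
    defined at every point. *)
Definition bmeas f := measurable_fun setT f /\ exists M, forall x, `|f x| <= M.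

Lemma measurable_sub_comp f : measurable_fun setT f ->
  measurable_fun [set: measurableTypeR R * measurableTypeR R]
    (fun z => f (z.1 - z.2)).
Proof.
move=> mf; apply: (measurableT_comp mf).
by apply: measurable_funB; [exact: measurable_fst|exact: measurable_snd].
Qed.

Lemma measurable_reflect f (x : R) : measurable_fun setT f ->
  measurable_fun setT (fun v : R => f (x - v)).
Proof.
by move=> mf; apply: measurableT_comp mf _; exact: measurable_funB.
Qed.

Lemma L1_reflect f (x : R) : L1 mu f -> L1 mu (fun v => f (x - v)).
Proof.
move=> f1; have := @L1_affine _ (-1) x _ _ f1.
rewrite oppr_eq0 oner_eq0 => /(_ isT); congr L1.
by apply/funext => v; rewrite mulN1r addrC.
Qed.

Lemma Rintegral_reflect f (x : R) : L1 mu f ->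
  \int[mu]_v f (x - v) = \int[mu]_v f v.
Proof.
move=> f1; rewrite (@Rintegral_affine _ (-1) x f) ?oppr_eq0 ?oner_eq0//.
rewrite normrN normr1 mul1r; apply: eq_Rintegral => v _.
by rewrite mulN1r addrC.
Qed.

Lemma L1_shift f (x : R) : L1 mu f -> L1 mu (fun v => f (v - x)).
Proof.
move=> f1; have := @L1_affine _ 1 (- x) _ (oner_neq0 _) f1; congr L1.
by apply/funext => v; rewrite mul1r.
Qed.

Lemma Rintegral_shift f (x : R) : L1 mu f ->
  \int[mu]_v f (v - x) = \int[mu]_v f v.
Proof.
move=> f1; rewrite (@Rintegral_affine _ 1 (- x) f) ?oner_eq0//.
by rewrite normr1 mul1r; apply: eq_Rintegral => v _; rewrite mul1r.
Qed.

Lemma bmeasM f g : bmeas f -> bmeas g -> bmeas (fun x => f x * g x).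
Proof.
move=> [mf [M fM]] [mg [N gN]]; split; first exact: measurable_funM.
by exists (M * N) => x; rewrite normrM ler_pM.
Qed.

Lemma L1_conv f k (x : R) : bmeas f -> L1 mu k ->
  L1 mu (fun v => f (x - v) * k v).
Proof.
move=> [mf [M fM]] k1; apply: (@L1_bounded_mul _ _ _ _ _ _ M) => //.
exact: measurable_reflect.
Qed.

Lemma conv_le f k (M x : R) : measurable_fun setT f ->
  (forall x, `|f x| <= M) -> L1 mu k -> `|conv f k x| <= M * \int[mu]_v `|k v|.
Proof. by move=> mf fM k1; apply: Rint_bound => //; exact: measurable_reflect. Qed.

Lemma bmeas_conv f k : bmeas f -> L1 mu k -> bmeas (conv f k).
Proof.
move=> [mf [M fM]] k1; split; last first.
  by exists (M * \int[mu]_v `|k v|) => x; exact: conv_le.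
apply: (@measurable_Rint _ _ (measurableTypeR R) (measurableTypeR R) R mu
  (fun z => f (z.1 - z.2) * k z.2)).
apply: measurable_funM; first exact: measurable_sub_comp.
by apply: measurableT_comp (L1_meas k1) measurable_snd.
Qed.

(** This form avoids [conv k1 k2], which for merely integrable kernels converges only almost
    everywhere. *)
Lemma conv_comm f k1 k2 (x : R) : bmeas f -> L1 mu k1 -> L1 mu k2 ->
  conv (conv f k1) k2 x = conv (conv f k2) k1 x.
Proof.
move=> bf L1k1 L1k2; have [mf [M fM]] := bf.
pose F (z : measurableTypeR R * measurableTypeR R) :=
  f (x - z.1 - z.2) * k1 z.2 * k2 z.1.
have mF : measurable_fun setT F.
  apply: measurable_funM.
    apply: measurable_funM.
      apply: (measurableT_comp mf).
      by apply: measurable_funB => //; exact: measurable_funB.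
    by apply: measurableT_comp (L1_meas L1k1) measurable_snd.
  by apply: measurableT_comp (L1_meas L1k2) measurable_fst.
have F1 (v : R) : L1 mu (fun w => F (v, w)).
  rewrite /F /=; under [X in L1 _ X]eq_fun do rewrite mulrC.
  exact/L1_Z/L1_conv.
have F2 (w : R) : L1 mu (fun v => F (v, w)).
  rewrite /F /=; under [X in L1 _ X]eq_fun do
    rewrite -mulrA [_ * k2 _]mulrC mulrA [_ * k1 _]mulrC addrAC.
  exact/L1_Z/L1_conv.
have [] := @Rfubini _ _ (measurableTypeR R) (measurableTypeR R) R mu mu F
  (fun w => M * \int[mu]_v `|k2 v| * `|k1 w|) mF F1 F2.
- move=> w; rewrite /F /= mulrAC -RintZl; last exact: L1_abs.
  apply: le_Rintegral => //.
  + exact/L1_abs/F2.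
  + exact/L1_Z/L1_abs.
  + by move=> v _; rewrite !normrM ler_wpM2r// ler_wpM2r.
- exact/L1_Z/L1_abs.
move=> _ _ E; rewrite /conv.
transitivity (\int[mu]_v \int[mu]_w F (v, w)).
  apply: eq_Rintegral => v _; rewrite mulrC -RintZl; last exact: L1_conv.
  by apply: eq_Rintegral => w _; rewrite /F mulrC.
rewrite E; apply: eq_Rintegral => v _; rewrite mulrC -RintZl; last first.
  exact: L1_conv.
by apply: eq_Rintegral => w _; rewrite /F /= [x - w - v]addrAC; ring.
Qed.

(** Here [conv k1 k2] does occur; boundedness of [k1] makes it an everywhere convergent integral. In
    the application [k1] is a Fejer kernel. *)
Lemma conv_conv f k1 k2 (x : R) : bmeas f -> bmeas k1 -> L1 mu k1 ->
  L1 mu k2 -> conv (conv f k1) k2 x = conv f (conv k1 k2) x.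
Proof.
move=> bf bk1 L1k1 L1k2; have [mf [M fM]] := bf; have [mk1 [N k1N]] := bk1.
pose F (z : measurableTypeR R * measurableTypeR R) :=
  f (x - z.1) * k1 (z.1 - z.2) * k2 z.2.
have mF : measurable_fun setT F.
  apply: measurable_funM; last first.
    by apply: measurableT_comp (L1_meas L1k2) measurable_snd.
  apply: measurable_funM; last exact: measurable_sub_comp.
  by apply: (measurableT_comp mf); exact: measurable_funB.
have F1 (v : R) : L1 mu (fun w => F (v, w)).
  rewrite /F /=; under [X in L1 _ X]eq_fun do rewrite -mulrA.
  by apply: L1_Z; exact: L1_conv bk1 L1k2.
have F2 (w : R) : L1 mu (fun v => F (v, w)).
  rewrite /F /=; under [X in L1 _ X]eq_fun do rewrite mulrC.
  apply: L1_Z; apply: (@L1_bounded_mul _ _ _ _ _ _ M) => //.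
    exact: measurable_reflect.
  exact: L1_shift.
have [] := @Rfubini _ _ (measurableTypeR R) (measurableTypeR R) R mu mu F
  (fun w => M * \int[mu]_v `|k1 v| * `|k2 w|) mF F1 F2.
- move=> w; rewrite /F /= -(Rintegral_shift w (L1_abs L1k1)).
  rewrite mulrAC -RintZl; last exact: L1_shift (L1_abs L1k1).
  apply: le_Rintegral => //.
  + exact/L1_abs/F2.
  + by apply: L1_Z; exact: (L1_shift w (L1_abs L1k1)).
  + by move=> v _; rewrite !normrM mulrAC ler_wpM2r// ler_wpM2r.
- exact/L1_Z/L1_abs.
move=> _ _ E; rewrite /conv; transitivity (\int[mu]_v \int[mu]_w F (v, w)).
  rewrite E; apply: eq_Rintegral => w _; rewrite mulrC -RintZl; last first.
    exact: L1_conv.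
  have h : L1 mu (fun v => k2 w * (f (x - w - v) * k1 v)) by exact/L1_Z/L1_conv.
  rewrite -(Rintegral_shift w h); apply: eq_Rintegral => v _.
  by rewrite /F /= [k2 w * _]mulrC; congr (f _ * _ * _); ring.
apply: eq_Rintegral => v _; rewrite -RintZl; last first.
  exact: L1_conv bk1 L1k2.
by apply: eq_Rintegral => w _; rewrite /F mulrA.
Qed.

(** Dominated convergence along sequences: for fixed [v] the point [x - v] still tends to +oo, and
    [f] is bounded on the whole line. *)
Lemma conv_cvg0 f k : bmeas f -> L1 mu k ->
  f x @[x --> +oo] --> 0 -> conv f k x @[x --> +oo] --> 0.
Proof.
move=> bf k1 f0; have [mf [M fM]] := bf.
apply/cvg_pinftyP => u uoo.
rewrite [X in _ --> X](_ : 0 = \int[mu]_v (cst 0 v)); last first.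
  by rewrite Rintegral_cst//= mul0r.
apply: (@dct_seq _ _ _ mu (fun n v => f (u n - v) * k v) (cst 0)
  (fun v => M * `|k v|)).
- move=> n; apply: measurable_funM; last exact: (L1_meas k1).
  exact: measurable_reflect.
- exact: (@measurable_cst _ _ _ _ setT (0 : R)).
- exact/L1_Z/L1_abs.
- by move=> n v; rewrite normrM; apply: ler_wpM2r.
move=> v; rewrite -[X in _ --> X](mul0r (k v)); apply: cvgM; last exact: cvg_cst.
move/cvg_pinftyP : f0; apply.
apply/cvgryPge => A; move/cvgryPge : uoo => /(_ (A + v)).
by apply: filterS => n; rewrite lerBrDr.
Qed.

End convolution_on_the_line.

(** * The Fejer kernel: closed form, decay and positivity *)

Section fejer_kernel.
Context (R : realType).
Notation mu := (@lebesgue_measure R).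

Lemma integral_derive (F f : R -> R) (a b : R) : a < b ->
  (forall x : R, is_derive x 1 F (f x)) -> continuous f ->
  (\int[mu]_(x in `[a, b]) (f x)%:E = (F b - F a)%:E)%E.
Proof.
move=> ab dF cf; have cF : continuous F.
  by move=> x; apply: differentiable_continuous; apply/derivable1_diffP.
rewrite (@continuous_FTC2 _ f F) ?EFinB//.
- by apply: continuous_subspaceT.
- split => //; first by apply: cvg_at_right_filter; exact: cF.
  by apply: cvg_at_left_filter; exact: cF.
- by move=> x _; rewrite derive1E derive_val.
Qed.

Lemma continuous_dct d (T : measurableType d) (m : {measure set T -> \bar R})
    (F : R -> T -> R) (g : T -> R) :
  (forall u, measurable_fun setT (F u)) -> L1 m g ->
  (forall u x, `|F u x| <= g x) -> (forall x, continuous (F ^~ x)) ->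
  continuous (fun u => \int[m]_x F u x).
Proof.
move=> mF g1 Fg cF u; apply/(@cvg_nbhsP _ R^o) => w wu.
apply: (@dct_seq _ _ _ m (fun n => F (w n)) (F u) g) => // x.
by move/(@cvg_nbhsP _ R^o) : (cF x u); apply.
Qed.

Lemma L1_oneDsqr : L1 mu (fun x => (1 + x ^+ 2)^-1).
Proof.
have c : continuous (fun x : R => (1 + x ^+ 2)^-1) := @continuous_oneDsqrV R.
have p x : 0 <= (1 + x ^+ 2)^-1 :> R by rewrite invr_ge0 addr_ge0 ?sqr_ge0.
apply/integrableP; split.
  by apply/measurable_EFinP; exact: continuous_measurable_fun.
under eq_integral do rewrite /comp gee0_abs ?lee_fin//.
rewrite ge0_symfun_integralT//; last by move=> x /=; rewrite sqrrN.
rewrite -set_itvcy integral0y_oneDsqr.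
by rewrite -EFinM ltry.
Qed.

Lemma continuous_cosM (u : R) : continuous (fun x : R => cos (x * u)).
Proof.
by move=> x; apply: continuous_comp; [exact: mulrr_continuous|exact: continuous_cos].
Qed.

Lemma measurable_cosM (u : R) : measurable_fun setT (fun x : R => cos (x * u)).
Proof. by apply: continuous_measurable_fun; exact: continuous_cosM u. Qed.

Lemma continuous_sinM (u : R) : continuous (fun x : R => sin (x * u)).
Proof.
by move=> x; apply: continuous_comp; [exact: mulrr_continuous|exact: continuous_sin].
Qed.

Lemma measurable_sinM (u : R) : measurable_fun setT (fun x : R => sin (x * u)).
Proof. by apply: continuous_measurable_fun; exact: continuous_sinM u. Qed.

Definition hat (x : R) : R := \1_`[0, 1] x * (1 - x).

Lemma measurable_hat : measurable_fun setT hat.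
Proof. by apply: measurable_funM => //; exact: measurable_funB. Qed.

Lemma hat_le x : 0 <= hat x <= \1_`[0, 1] x.
Proof.
rewrite /hat indicE; case: (boolP (x \in _)) => [|_]; last by rewrite mul0r lexx.
by rewrite inE /= in_itv /= => /andP[x0 x1]; rewrite mul1r; lra.
Qed.

Lemma L1_hat : L1 mu hat.
Proof.
apply: (@L1_le _ _ _ mu _ (\1_`[0, 1])); first exact: measurable_hat.
  exact: integrable_indic_itv.
by move=> x; have /andP[h0 h1] := hat_le x; rewrite ger0_norm.
Qed.

(** Half the Fourier transform of the triangle 1 - |x| on [-1, 1]. The integral form covers [u = 0],
    where the quotient in [fejer_eq] breaks down, and exhibits the kernel as a superposition of
    cosines. *)
Definition fejer (u : R) : R := \int[mu]_x (cos (x * u) * hat x).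

Lemma fejer_eq (u : R) : u != 0 -> fejer u = (1 - cos u) / u ^+ 2.
Proof.
move=> u0; pose F x := (1 - x) * sin (x * u) / u - cos (x * u) / u ^+ 2.
have dF (x : R) : is_derive x 1 F (cos (x * u) * (1 - x)).
  rewrite /F; apply: is_derive_eq; rewrite /GRing.scale /=; by field.
rewrite /fejer; have -> : \int[mu]_x (cos (x * u) * hat x) =
    \int[mu]_(x in `[0, 1]) (cos (x * u) * (1 - x)).
  rewrite [RHS]Rintegral_mkcond; apply: eq_Rintegral => x _.
  by rewrite patchE /hat indicE; case: ifP; rewrite ?mul1r ?mul0r ?mulr0.
rewrite /Rintegral (@integral_derive F) //.
  by rewrite /F /= !(mul1r, mul0r, subrr, cos0, sin0, mulr0); field.
move=> x; apply: cvgM; last by apply: cvgB; [exact: cvg_cst|exact: cvg_id].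
exact: continuous_cosM.
Qed.

Lemma continuous_fejer : continuous fejer.
Proof.
apply: (continuous_dct _ L1_hat).
- move=> u; apply: measurable_funM; last exact: measurable_hat.
  exact: measurable_cosM.
- move=> u x; have /andP[h0 h1] := hat_le x.
  by rewrite normrM (ger0_norm h0) ler_piMl// cos_max.
- move=> x u; apply: cvgM; last exact: cvg_cst.
  apply: (@continuous_comp _ _ _ ( *%R x) (@cos R)).
    exact: mulrl_continuous.
  exact: continuous_cos.
Qed.

Lemma fejer_ge0 u : 0 <= fejer u.
Proof.
have [->|u0] := eqVneq u 0.
  apply: Rintegral_ge0 => x _; rewrite mulr0 cos0 mul1r.
  by have /andP[] := hat_le x.
by rewrite fejer_eq// divr_ge0 ?sqr_ge0// subr_ge0 cos_le1.
Qed.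

(** Two bounds are added: [fejer u] is at most the integral of [hat], and [u ^+ 2 * fejer u] is 1 -
    cos u, at most 2. *)
Lemma fejer_le : exists2 M, 0 <= M & forall u, fejer u <= M * (1 + u ^+ 2)^-1.
Proof.
exists (\int[mu]_x `|hat x| + 2) => [|u].
  by rewrite addr_ge0// Rintegral_ge0.
have h : fejer u <= \int[mu]_x `|hat x|.
  rewrite -[leRHS]mul1r (le_trans (ler_norm _))//.
  apply: Rint_bound => //; [exact: measurable_cosM|by move=> x; exact: cos_max|exact: L1_hat].
rewrite ler_pdivlMr ?ltr_pwDl ?sqr_ge0// mulrDr mulr1 lerD//.
have [->|u0] := eqVneq u 0; first by rewrite expr0n mulr0.
by rewrite fejer_eq// divfK ?expf_neq0//; have := cos_geN1 u; lra.
Qed.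

Lemma measurable_fejer : measurable_fun setT fejer.
Proof. by apply: continuous_measurable_fun; exact: continuous_fejer. Qed.

Lemma L1_fejer : L1 mu fejer.
Proof.
have [M M0 hM] := fejer_le; apply: (L1_le _ (L1_Z M L1_oneDsqr)).
  exact: measurable_fejer.
by move=> u; rewrite ger0_norm// fejer_ge0.
Qed.

(** Kept as an unevaluated constant that normalises [fejerk]; for that, positivity suffices. *)
Definition fejer_mass : R := \int[mu]_u fejer u.

Lemma fejer_mass_gt0 : 0 < fejer_mass.
Proof.
have pi0 := pi_gt0 R.
(* On [pi/2, pi] the cosine is nonpositive, so the kernel is at least 1/u^2, hence at least
   1/pi^2. *)
pose h (u : R) := (pi ^+ 2)^-1 * \1_`[pi / 2, pi] u : R.
have h1 : L1 mu h by apply: L1_Z; exact: integrable_indic_itv.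
apply: (@lt_le_trans _ _ (\int[mu]_u h u)).
  rewrite RintZl; last exact: integrable_indic_itv.
  rewrite mulr_gt0 ?invr_gt0 ?exprn_gt0//.
  rewrite /Rintegral integral_indic//= setIT lebesgue_measure_itv /= lte_fin.
  by rewrite ifT/=; lra.
apply: le_Rintegral => //; first exact: L1_fejer.
move=> u _; rewrite /h indicE; case: (boolP (u \in _)); last first.
  by rewrite mulr0 fejer_ge0.
rewrite inE /= in_itv /= => /andP[u0 u1]; rewrite fejer_eq; last by lra.
have c0 : cos u <= 0.
  rewrite -cos_pihalf; have [->|ne] := eqVneq u (pi / 2) => //.
  by apply/ltW; rewrite ltr_cos ?in_itv/=; lra.
rewrite mulr1 -[leLHS]mul1r ler_pM ?invr_ge0 ?sqr_ge0//; first by lra.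
by rewrite lef_pV2 ?posrE ?exprn_gt0 ?ler_sqr ?nnegrE//; lra.
Qed.

End fejer_kernel.

(** * Fourier transforms of the Fejer and de la Vallee-Poussin kernels *)

Section fejer_transform.
Context (R : realType).
Notation mu := (@lebesgue_measure R).
Notation C := (fejer_mass R).
Implicit Types (a d u x : R).

Lemma fejerN u : fejer (- u) = fejer u.
Proof. by apply: eq_Rintegral => x _; rewrite mulrN cosN. Qed.

(** The closed form with denominators cleared, so that it also holds when [a * u = 0]. *)
Lemma fejer_sqr a u : a ^+ 2 * fejer (a * u) * u ^+ 2 = 1 - cos (a * u).
Proof.
have [/eqP|au0] := eqVneq (a * u) 0; last first.
  by rewrite fejer_eq// mulrAC -exprMn mulrC divfK// expf_neq0.
by rewrite mulf_eq0 => /orP[]/eqP->; rewrite !(mulr0, mul0r) ?expr0n/= !(mulr0, mul0r) cos0 subrr.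
Qed.

(** After multiplication by u^2 this is the product formula for cos u cos (x u). Modulation thus
    becomes dilation, and the transform follows from the mass of the dilated kernels alone. *)
Lemma fejer_mul_cos x u : fejer u * cos (x * u) =
  2^-1 * ((1 + x) ^+ 2 * fejer ((1 + x) * u))
  + 2^-1 * ((1 - x) ^+ 2 * fejer ((1 - x) * u)) - x ^+ 2 * fejer (x * u).
Proof.
have [->|u0] := eqVneq u 0.
  by rewrite !mulr0 cos0; field.
have u20 : u ^+ 2 != 0 by rewrite expf_neq0.
apply: (mulIf u20); rewrite mulrBl mulrDl.
rewrite -![2^-1 * _ * _]mulrA !fejer_sqr.
have := fejer_sqr 1 u; rewrite expr1n !mul1r => h.
have -> : (1 + x) * u = u + x * u by ring.
have -> : (1 - x) * u = u - x * u by ring.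
by rewrite mulrAC h cosD cosB; field.
Qed.

Lemma L1_fejerM a : L1 mu (fun u => a ^+ 2 * fejer (a * u)).
Proof.
have [->|a0] := eqVneq a 0.
  under [X in L1 _ X]eq_fun do rewrite expr0n mul0r; exact: integrable0.
apply: L1_Z; have := L1_affine 0 a0 (@L1_fejer R); congr L1.
by apply/funext => u; rewrite addr0.
Qed.

Lemma Rintegral_fejerM a : \int[mu]_u (a ^+ 2 * fejer (a * u)) = `|a| * C.
Proof.
have [->|a0] := eqVneq a 0.
  rewrite normr0 mul0r; under eq_Rintegral do rewrite expr0n mul0r.
  exact: Rint0.
have h : L1 mu (fun u => fejer (a * u)).
  have := L1_affine 0 a0 (@L1_fejer R); congr L1.
  by apply/funext => u; rewrite addr0.
rewrite (RintZl _ h) /fejer_mass (Rintegral_affine 0 a0 (@L1_fejer R)).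
under [in RHS]eq_Rintegral do rewrite addr0.
by rewrite mulrA -normrM -expr2 ger0_norm ?sqr_ge0.
Qed.

Lemma L1_mul_cos f x : L1 mu f -> L1 mu (fun u => cos (x * u) * f u).
Proof.
move=> f1; apply: (@L1_bounded_mul _ _ _ _ _ _ 1) => //.
  by under eq_fun do rewrite mulrC; exact: measurable_cosM.
by move=> u; exact: cos_max.
Qed.

Lemma L1_mul_sin f x : L1 mu f -> L1 mu (fun u => sin (x * u) * f u).
Proof.
move=> f1; apply: (@L1_bounded_mul _ _ _ _ _ _ 1) => //.
  by under eq_fun do rewrite mulrC; exact: measurable_sinM.
by move=> u; exact: sin_max.
Qed.

(** The right-hand side is [C] times the triangle 1 - |x| on [-1, 1], zero outside, in the form that
    the three dilations produce. *)
Lemma fejer_transform x :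
  \int[mu]_u (cos (x * u) * fejer u) =
  2^-1 * (`|1 + x| + `|1 - x| - 2 * `|x|) * C.
Proof.
under eq_Rintegral do rewrite mulrC fejer_mul_cos.
have h a : L1 mu (fun u => 2^-1 * (a ^+ 2 * fejer (a * u))).
  exact: L1_Z (L1_fejerM a).
rewrite (RintB (L1_D (h _) (h _)) (L1_fejerM _)) (RintD (h _) (h _)).
rewrite (RintZl _ (L1_fejerM (1 + x))) (RintZl _ (L1_fejerM (1 - x))).
by rewrite !Rintegral_fejerM; field.
Qed.

Definition fejerk d u : R := d / C * fejer (d * u).

(** Twice the triangle of half-width [2 * d] minus the triangle of half-width [d] equals 1 on
    [-d, d]; that is the transform of this kernel there. *)
Definition vpk d u : R := 2 * fejerk (2 * d) u - fejerk d u.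

Lemma vpkN d u : vpk d (- u) = vpk d u.
Proof. by rewrite /vpk /fejerk !mulrN !fejerN. Qed.

Lemma L1_fejerk d : 0 < d -> L1 mu (fejerk d).
Proof.
move=> d0; apply: L1_Z.
have := L1_affine 0 (lt0r_neq0 d0) (@L1_fejer R); congr L1.
by apply/funext => u; rewrite addr0.
Qed.

Lemma L1_vpk d : 0 < d -> L1 mu (vpk d).
Proof. by move=> d0; apply: L1_B; [apply: L1_Z|]; apply: L1_fejerk; rewrite ?mulr_gt0. Qed.

Lemma bmeas_fejerk d : bmeas (fejerk d).
Proof.
split.
  apply: measurable_funM => //; apply: (measurableT_comp (@measurable_fejer R)).
  exact: measurable_funM.
have [M M0 hM] := fejer_le R; exists (`|d / C| * M) => u.
rewrite normrM ler_wpM2l// ger0_norm ?fejer_ge0// (le_trans (hM _))//.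
by rewrite ler_piMr// invf_le1 ?ltr_pwDl ?sqr_ge0// lerDl sqr_ge0.
Qed.

Lemma fejerk_transform d x : 0 < d -> 0 <= x <= d ->
  \int[mu]_u (cos (x * u) * fejerk d u) = 1 - x / d.
Proof.
move=> d0 /andP[x0 xd]; have C0 := fejer_mass_gt0 R.
have dn0 := lt0r_neq0 d0.
have h := L1_mul_cos (x / d) (@L1_fejer R).
have h' : L1 mu (fun u => cos (x / d * (d * u)) * fejer (d * u)).
  have := L1_affine 0 dn0 h; congr L1.
  by apply/funext => u; rewrite addr0.
transitivity (C^-1 * (d * \int[mu]_u (cos (x / d * (d * u)) * fejer (d * u)))).
  rewrite -(RintZl _ h') -(RintZl _ (L1_Z _ h')).
  apply: eq_Rintegral => u _; rewrite /fejerk (mulrA (x / d)) divfK//; ring.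
have := Rintegral_affine 0 dn0 h; rewrite gtr0_norm//.
under [in X in _ = X -> _]eq_Rintegral do rewrite addr0.
move=> <-; rewrite fejer_transform mulrC mulfK ?gt_eqF//.
have h1 : x / d <= 1 by rewrite ler_pdivrMr ?mul1r.
have h0 : 0 <= x / d by rewrite divr_ge0// ltW.
rewrite !ger0_norm//; first by field.
- by rewrite subr_ge0.
- by rewrite addr_ge0.
Qed.

Lemma vpk_cos d x : 0 < d -> 0 <= x <= d -> \int[mu]_u (cos (x * u) * vpk d u) = 1.
Proof.
move=> d0 /andP[x0 xd]; have d20 : 0 < 2 * d by rewrite mulr_gt0.
transitivity (\int[mu]_u (2 * (cos (x * u) * fejerk (2 * d) u)
                          - cos (x * u) * fejerk d u)).
  by apply: eq_Rintegral => u _; rewrite /vpk; ring.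
have h e : 0 < e -> L1 mu (fun u => cos (x * u) * fejerk e u).
  by move=> e0; apply: L1_mul_cos; exact: L1_fejerk.
rewrite (RintB (L1_Z 2 (h _ d20)) (h _ d0)) (RintZl _ (h _ d20)).
rewrite !fejerk_transform//; [by field; rewrite gt_eqF|by rewrite x0|].
by rewrite x0 /=; lra.
Qed.

Lemma vpk_sin d x : 0 < d -> \int[mu]_u (sin (x * u) * vpk d u) = 0.
Proof.
move=> d0; have h := L1_mul_sin x (L1_vpk d0).
have := Rintegral_reflect 0 h.
under eq_Rintegral do rewrite sub0r mulrN sinN vpkN mulNr -mulN1r.
by rewrite (RintZl _ h); lra.
Qed.

Lemma L1_cos_hat u : L1 mu (fun x => cos (x * u) * hat x).
Proof.
apply: (@L1_bounded_mul _ _ _ _ _ _ 1); last exact: L1_hat.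
  exact: measurable_cosM.
by move=> x; exact: cos_max.
Qed.

(** By definition of [fejer], the kernel [fejerk d] is a mixture of the cosines of frequency [x * d]
    with [x] in [0, 1]. By [vpk_cos] and [vpk_sin] each of them is fixed by [vpk d], and Fubini
    interchanges the two integrals. *)
Lemma conv_fejerk_vpk d v : 0 < d -> conv (fejerk d) (vpk d) v = fejerk d v.
Proof.
move=> d0.
pose F (z : measurableTypeR R * measurableTypeR R) :=
  cos (z.2 * (d * (v - z.1))) * hat z.2 * vpk d z.1.
have mF : measurable_fun setT F.
  apply: measurable_funM; last first.
    by apply: measurableT_comp (L1_meas (L1_vpk d0)) measurable_fst.
  apply: measurable_funM; last first.
    by apply: measurableT_comp (@measurable_hat R) measurable_snd.
  apply: measurableT_comp.
    by apply: continuous_measurable_fun; exact: continuous_cos.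
  apply: measurable_funM => //; apply: measurable_funM => //.
  exact: measurable_funB.
have F1 (s : R) : L1 mu (fun x => F (s, x)).
  have := L1_Z (vpk d s) (L1_cos_hat (d * (v - s))); congr L1.
  by apply/funext => x; rewrite /F /=; ring.
have F2 (x : R) : L1 mu (fun s => F (s, x)).
  rewrite /F /=; apply: (@L1_bounded_mul _ _ _ _ _ _ (hat x)); last exact: L1_vpk.
    apply: measurable_funM; last exact: measurable_cst.
    apply: (@measurable_reflect _ (fun w => cos (x * (d * w)))).
    apply: continuous_measurable_fun => w.
    apply: (@continuous_comp _ _ _ (fun w => x * (d * w))).
      by apply: cvgM; [exact: cvg_cst|exact: mulrl_continuous].
    exact: continuous_cos.
  move=> s; have /andP[h0 _] := hat_le x.
  by rewrite normrM (ger0_norm h0) ler_piMl// cos_max.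
have K1 := L1_abs (L1_vpk d0).
have [||I1 _ E] := @Rfubini _ _ (measurableTypeR R) (measurableTypeR R) R mu mu F
  (fun x => (\int[mu]_s `|vpk d s|) * hat x) mF F1 F2.
- move=> x; rewrite mulrC -(RintZl _ K1); apply: le_Rintegral => //.
  + exact/L1_abs/F2.
  + exact: L1_Z K1.
  move=> s _; have /andP[h0 _] := hat_le x.
  rewrite /F /= normrM [X in X * _]normrM (ger0_norm h0) -mulrA.
  by apply: ler_piMl; [exact: mulr_ge0|exact: cos_max].
- exact: L1_Z (@L1_hat R).
transitivity (d / C * \int[mu]_s \int[mu]_x F (s, x)).
  rewrite -(RintZl _ I1); apply: eq_Rintegral => s _.
  rewrite /fejerk -mulrA; congr (_ * _); rewrite mulrC /fejer.
  rewrite -RintZl; last first.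
    exact: L1_cos_hat.
  by apply: eq_Rintegral => x _; rewrite /F /=; ring.
rewrite E /fejerk /fejer; congr (_ * _); apply: eq_Rintegral => x _.
(* Outside [0, 1] the weight [hat x] vanishes; inside, the frequency [x * d] lies in the range of
   [vpk_cos]. *)
have [x01|x01] := boolP (x \in `[0, 1]%classic); last first.
  rewrite /F /hat indicE (negbTE x01) mul0r mulr0.
  rewrite -[RHS](Rint0 mu); apply: eq_Rintegral => s _.
  by rewrite /= mulr0 mul0r.
have /andP[x0 x1] : 0 <= x <= 1 by move: x01; rewrite inE /= in_itv.
have hc := L1_mul_cos (x * d) (L1_vpk d0).
have hs := L1_mul_sin (x * d) (L1_vpk d0).
transitivity (\int[mu]_s ((cos (x * d * v) * hat x) * (cos (x * d * s) * vpk d s)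
   + (sin (x * d * v) * hat x) * (sin (x * d * s) * vpk d s))).
  apply: eq_Rintegral => s _; rewrite /F /=.
  have -> : x * (d * (v - s)) = x * d * v - x * d * s by ring.
  by rewrite cosB; ring.
rewrite (RintD (L1_Z _ hc) (L1_Z _ hs)) (RintZl _ hc) (RintZl _ hs).
have xd : 0 <= x * d <= d.
  have d0' := ltW d0; apply/andP; split; first exact: mulr_ge0.
  exact: ler_piMl.
by rewrite (vpk_sin _ d0) (vpk_cos d0 xd) mulr0 addr0 mulr1 mulrA.
Qed.

End fejer_transform.

(** * Continuity of translation in L1 for the de la Vallee-Poussin kernel *)

Section modulus_of_translation.
Context (R : realType).
Notation mu := (@lebesgue_measure R).
Implicit Types (d u x v w : R).

Definition osc d w : R := \int[mu]_v `|vpk d v - vpk d (v - w)|.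

Lemma continuous_vpk d : continuous (vpk d : R -> R).
Proof.
have c e : continuous (fejerk e : R -> R).
  move=> u; apply: cvgM; first exact: cvg_cst.
  apply: (@continuous_comp _ _ _ ( *%R e) (@fejer R)).
    exact: mulrl_continuous.
  exact: continuous_fejer.
by move=> u; apply: cvgB; [apply: cvgM; [exact: cvg_cst|exact: c]|exact: c].
Qed.

Lemma vpk_scale d u : vpk d u = d * vpk 1 (d * u).
Proof.
rewrite /vpk /fejerk; have -> : 2 * 1 * (d * u) = 2 * d * u by ring.
by have -> : 1 * (d * u) = d * u; ring.
Qed.

Lemma vpk_le : exists2 M, 0 <= M & forall u, `|vpk 1 u| <= M * (1 + u ^+ 2)^-1.
Proof.
have [M M0 hM] := fejer_le R; have C0 := fejer_mass_gt0 R.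
set C := fejer_mass R in C0.
have fk e u : 1 <= e -> `|fejerk e u| <= e / C * M * (1 + u ^+ 2)^-1.
  move=> e1; have e0 : 0 <= e / C by rewrite divr_ge0//; lra.
  rewrite /fejerk normrM (ger0_norm (fejer_ge0 _)) (ger0_norm e0) -mulrA.
  apply: ler_wpM2l => //; apply: (le_trans (hM _)).
  rewrite ler_wpM2l// lef_pV2 ?posrE ?ltr_pwDl ?sqr_ge0//.
  by rewrite lerD2l exprMn ler_peMl ?sqr_ge0// expr_ge1//; lra.
exists (2 * (2 / C * M) + 1 / C * M) => [|u].
  by rewrite addr_ge0// !mulr_ge0// ?invr_ge0//; lra.
apply: (le_trans (ler_normB _ _)); rewrite mulr1 [leRHS]mulrDl.
apply: lerD; last exact: fk.
by rewrite normrM ger0_norm// -[leRHS]mulrA ler_wpM2l// fk// ler1n.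
Qed.

Lemma L1_vpkB d w : 0 < d -> L1 mu (fun v => vpk d v - vpk d (v - w)).
Proof. by move=> d0; have h := L1_vpk d0; exact: L1_B h (L1_shift w h). Qed.

Lemma osc_ge0 d w : 0 <= osc d w.
Proof. by apply: Rintegral_ge0. Qed.

Lemma osc_le d w : 0 < d -> osc d w <= 2 * \int[mu]_v `|vpk d v|.
Proof.
move=> d0; have h := L1_abs (L1_vpk d0).
have hs := L1_shift w h.
rewrite mulr_natl mulr2n -{2}(Rintegral_shift w h) -(RintD h hs).
apply: le_Rintegral => //; [exact: L1_abs (L1_vpkB w d0)|exact: L1_D|].
by move=> v _; exact: ler_normB.
Qed.

(** Lowering the bandwidth amounts to shrinking the shift, so continuity of translation at bandwidth
    1 controls all small [d]. *)
Lemma osc_scale d w : 0 < d -> osc d w = osc 1 (w * d).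
Proof.
move=> d0; have h := L1_abs (L1_vpkB (w * d) (@ltr01 R)).
rewrite {2}/osc (Rintegral_affine 0 (lt0r_neq0 d0) h) gtr0_norm//.
have h' := L1_affine 0 (lt0r_neq0 d0) h.
rewrite -(RintZl _ h'); apply: eq_Rintegral => v _.
rewrite addr0 2!(vpk_scale d) -mulrBr normrM gtr0_norm//.
by congr (_ * `|_ - vpk _ _|); ring.
Qed.

Lemma measurable_osc d : 0 < d -> measurable_fun setT (osc d).
Proof.
move=> d0.
apply: (@measurable_Rint _ _ (measurableTypeR R) (measurableTypeR R) R mu
  (fun z => `|vpk d z.2 - vpk d (z.2 - z.1)|)).
apply: measurableT_comp => //; have mv := L1_meas (L1_vpk d0).
apply: measurable_funB; first exact: measurableT_comp mv measurable_snd.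
by apply: measurableT_comp mv _; exact: measurable_funB.
Qed.

Lemma osc_cvg0 (e : nat -> R) : e n @[n --> \oo] --> 0 ->
  osc 1 (e n) @[n --> \oo] --> 0.
Proof.
move=> e0; have [M M0 hM] := vpk_le; have v1 := L1_vpk (@ltr01 R).
have osc0 : osc 1 0 = 0.
  rewrite -[RHS](Rint0 mu); apply: eq_Rintegral => v _.
  by rewrite subr0 subrr normr0.
suff : {for 0, continuous (osc 1)}.
  by move/(@cvg_nbhsP _ R^o); rewrite osc0; exact.
(* For shifts with |w| at most 1, 1 + v^2 is at most 3 (1 + (v - w)^2); the factor 4 is 1 for the
   kernel plus 3 for its translate. *)
pose g v := 4 * M * (1 + v ^+ 2)^-1.
have /= := @continuity_under_integral _ _ _ mu
  (fun w v => `|vpk 1 v - vpk 1 (v - w)|) setT measurableT (-1) 1 _ _ g _ _ 0.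
apply.
- by move=> w _; exact: L1_abs (L1_vpkB w (@ltr01 R)).
- apply: aeW => v _ w _ /=; apply: cvg_norm; apply: cvgB; first exact: cvg_cst.
  apply: (@continuous_comp _ _ _ (fun w => v - w)); last exact: continuous_vpk.
  by apply: cvgB; [exact: cvg_cst|exact: cvg_id].
- exact: L1_Z (@L1_oneDsqr R).
- move=> w; rewrite /= in_itv /= => /andP[w0 w1]; apply: aeW => v _.
  rewrite normr_id (le_trans (ler_normB _ _))//.
  have -> : g v = M * (1 + v ^+ 2)^-1 + 3 * (M * (1 + v ^+ 2)^-1).
    by rewrite /g; ring.
  rewrite lerD// (le_trans (hM _))// mulrCA ler_wpM2l//.
  rewrite -[leLHS]mul1r ler_pdivrMr ?ltr_pwDl ?sqr_ge0//.
  rewrite mulrAC ler_pdivlMr ?ltr_pwDl ?sqr_ge0// mul1r.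
  have w2 : w ^+ 2 <= 1 by nra.
  have := sqr_ge0 (v - 2 * w); have := sqr_ge0 (v - w).
  nra.
- by rewrite inE /= in_itv /= ltrN10 ltr01.
Qed.

Lemma osc_integral_cvg0 (g : R -> R) (e : nat -> R) : L1 mu g ->
  e n @[n --> \oo] --> 0 ->
  \int[mu]_w (osc 1 (w * e n) * `|g w|) @[n --> \oo] --> 0.
Proof.
move=> g1 e0; rewrite -[X in _ --> X](Rint0 mu).
have d1 := @ltr01 R.
apply: (@dct_seq _ _ _ mu (fun n w => osc 1 (w * e n) * `|g w|) (cst 0)
  (fun w => 2 * (\int[mu]_v `|vpk 1 v|) * `|g w|)).
- move=> n; apply: measurable_funM; last exact: L1_meas (L1_abs g1).
  by apply: (measurableT_comp (measurable_osc d1)); exact: measurable_funM.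
- exact: (@measurable_cst _ _ _ _ setT (0 : R)).
- exact/L1_Z/L1_abs.
- move=> n w; rewrite normrM normr_id ger0_norm ?osc_ge0//.
  by apply: ler_wpM2r => //; exact: osc_le.
move=> w; rewrite -[X in _ --> X](mul0r `|g w|); apply: cvgM; last exact: cvg_cst.
apply: osc_cvg0; rewrite -[X in _ --> X](mulr0 w).
by apply: cvgM; [exact: cvg_cst|exact: e0].
Qed.

End modulus_of_translation.

(** * Wiener's theorem for Fejer kernels *)

Section local_tauberian.
Context (R : realType).
Notation mu := (@lebesgue_measure R).
Implicit Types (f g a b k e : R -> R) (d m x y : R).

(** Since [A] is reproduced by [vpk d], the variation is the integral of [A (x - v)] against [vpk d]
    minus its translate. The part [m] of the bound on [A] gives [osc]; the part [e] gives the two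
    convolution terms. *)
Lemma bmeas_fejerk_variation a e d m x w : bmeas a -> bmeas e ->
  (forall x, 0 <= e x) -> 0 < d ->
  (forall x, `|conv a (fejerk d) x| <= m + e x) ->
  `|conv a (fejerk d) x - conv a (fejerk d) (x - w)| <=
  m * osc d w + (conv e (fun v => `|vpk d v|) x
    + conv e (fun v => `|vpk d v|) (x - w)).
Proof.
move=> ba be e0 d0; set A := conv a (fejerk d) => Ae.
have v1 := L1_vpk d0; have f1 := L1_fejerk d0.
have bA : bmeas A := bmeas_conv ba f1.
(* The reproduction [A = conv A (vpk d)], by associativity from [conv_fejerk_vpk]. *)
have AV z : A z = conv A (vpk d) z.
  rewrite [RHS](conv_conv _ ba (bmeas_fejerk d) f1 v1).
  by apply: eq_Rintegral => u _; rewrite conv_fejerk_vpk.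
have shift b z : bmeas b -> forall k, L1 mu k ->
    conv b k (z - w) = \int[mu]_v (b (z - v) * k (v - w)).
  move=> bb k k1; rewrite /conv -(Rintegral_shift w (L1_conv (z - w) bb k1)).
  by apply: eq_Rintegral => v _; congr (b _ * _); ring.
have Lshift b z : bmeas b -> forall k, L1 mu k ->
    L1 mu (fun v => b (z - v) * k (v - w)).
  by move=> bb k k1; apply: (L1_conv z bb); exact: L1_shift.
have va1 := L1_abs v1.
rewrite {1}AV {1}AV (shift A)// [X in `|X - _|]/conv.
rewrite -RintB; [|exact: L1_conv|exact: Lshift].
rewrite (shift e)// [X in _ + (X + _)]/conv /osc.
have Ld := L1_abs (L1_vpkB w d0).
have Le1 := L1_conv x be va1; have Le2 := Lshift e x be _ va1.
rewrite -(RintZl _ Ld) -(RintD Le1 Le2) -(RintD (L1_Z m Ld) (L1_D Le1 Le2)).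
apply: Rint_le.
- apply: L1_meas; apply: L1_B; [exact: L1_conv bA v1|exact: Lshift bA _ v1].
- exact: L1_D (L1_Z m Ld) (L1_D Le1 Le2).
move=> v; rewrite -mulrBr normrM.
apply: (le_trans (ler_wpM2r (normr_ge0 _) (Ae (x - v)))).
by rewrite mulrDl lerD2l -mulrDr ler_wpM2l// ler_normB.
Qed.

(* [A] is reproduced by the de la Vallee-Poussin kernel, hence varies slowly at
   scale [1 / d]; convolving with [k] then nearly multiplies it by its mean. *)
Lemma conv_fejerk_mean a e g k d m x : bmeas a -> bmeas e ->
  (forall x, 0 <= e x) -> 0 < d -> L1 mu g -> L1 mu k ->
  (forall w, `|k w| <= `|g w|) ->
  (forall x, `|conv a (fejerk d) x| <= m + e x) ->
  `|conv a (fejerk d) x * (\int[mu]_w k w) - conv (conv a (fejerk d)) k x| <=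
  m * (\int[mu]_w (osc d w * `|g w|)) +
  ((\int[mu]_w `|g w|) * conv e (fun v => `|vpk d v|) x +
   conv (conv e (fun v => `|vpk d v|)) (fun w => `|g w|) x).
Proof.
move=> ba be e0 d0 g1 k1 kg Ae.
have bA := bmeas_conv ba (L1_fejerk d0).
have bE := bmeas_conv be (L1_abs (L1_vpk d0)).
have ag1 := L1_abs g1; have v1 := L1_vpk d0.
set A := conv a _ in bA *; set E := conv e _ in bE *.
have og1 : L1 mu (fun w => osc d w * `|g w|).
  apply: (@L1_bounded_mul _ _ _ _ _ _ (2 * \int[mu]_v `|vpk d v|)) => //.
    exact: measurable_osc.
  by move=> w; rewrite ger0_norm ?osc_ge0 ?osc_le.
have Eg1 := L1_conv x bE ag1; have mE := L1_Z (E x) ag1.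
rewrite -(RintZl _ k1) /conv -(RintB (L1_Z (A x) k1) (L1_conv x bA k1)).
rewrite [(\int[mu]_w `|g w|) * _]mulrC -(RintZl _ ag1) -(RintD mE Eg1) -(RintZl _ og1).
rewrite -(RintD (L1_Z _ og1) (L1_D mE Eg1)).
apply: Rint_le.
- by apply: L1_meas; exact: L1_B (L1_Z (A x) k1) (L1_conv x bA k1).
- exact: L1_D (L1_Z _ og1) (L1_D mE Eg1).
move=> w; rewrite -mulrBl normrM mulrA -!mulrDl.
apply: ler_pM => //; exact: bmeas_fejerk_variation.
Qed.

(** The excess is eventually zero. It turns an eventual bound [m] into a global bound with a
    vanishing error, as convolution requires. *)
Lemma excess_cvg0 f m : (\forall x \near +oo, `|f x| <= m) ->
  Num.max (`|f x| - m) 0 @[x --> +oo] --> 0.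
Proof.
move=> fm; apply: cvg_near_cst; near=> x; apply/max_idPr.
by rewrite subr_le0; near: x.
Unshelve. all: end_near. Qed.

Lemma bmeas_excess f m : bmeas f -> bmeas (fun x => Num.max (`|f x| - m) 0).
Proof.
move=> [mf [M fM]]; split.
  by apply: measurable_maxr => //; apply: measurable_funB => //; exact: measurableT_comp.
exists (M + `|m|) => x; rewrite ger0_norm ?le_max ?lexx ?orbT//.
have M0 := le_trans (normr_ge0 _) (fM x).
rewrite ge_max addr_ge0// andbT lerD//.
by rewrite -normrN ler_norm.
Qed.

Lemma bmeasD f g : bmeas f -> bmeas g -> bmeas (fun x => f x + g x).
Proof.
move=> [mf [M fM]] [mg [N gN]]; split; first exact: measurable_funD.
by exists (M + N) => x; rewrite (le_trans (ler_normD _ _))// lerD.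
Qed.

Lemma ler_norm_pair (u u' v v' K eta : R) : `|u - u'| <= K -> `|v - v'| <= K ->
  `|u' + v'| <= eta -> `|u + v| <= 2 * K + eta.
Proof.
rewrite !ler_norml => /andP[u1 u2] /andP[v1 v2] /andP[w1 w2].
by apply/andP; split; lra.
Qed.

(** The products add up to 2 G (2 m Om + 3 eta). Smallness of [Om] makes 4 m Om G at most D m / 2,
    and the choice of [eta] makes 6 eta G at most D m / 4. The summand 1 in 6 G + 1 keeps that
    factor positive even if G = 0. *)
Lemma contraction_bound (z u v c s D G m Om eta : R) : 0 <= G -> 0 < D -> 0 < m ->
  `|c| <= G -> `|s| <= G -> 8 * Om * G <= D ->
  eta * (4 * (6 * G + 1)) = D * m -> 0 < eta -> z * D = u * c + v * s ->
  `|u| <= 2 * (m * Om) + 3 * eta -> `|v| <= 2 * (m * Om) + 3 * eta ->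
  `|z| <= 3 / 4 * m.
Proof.
move=> G0 D0 m0 Gc Gs small etaE eta0 zD hu hv.
rewrite -(ler_pM2r D0) -{1}(gtr0_norm D0) -normrM zD.
apply: (le_trans (ler_normD _ _)); rewrite !normrM.
have h1 := ler_pM (normr_ge0 _) (normr_ge0 _) hu Gc.
have h2 := ler_pM (normr_ge0 _) (normr_ge0 _) hv Gs.
have h3 : m * (8 * Om * G) <= m * D by rewrite ler_pM2l.
have h4 : 6 * eta * G <= 1 / 4 * (D * m) by rewrite -etaE; lra.
apply: (le_trans (lerD h1 h2)); lra.
Qed.

(** Read A + iB as one complex function and c + is as the integral of gc + i gs. The two limits say
    that (A + iB) convolved with gc + i gs vanishes at infinity, and by [conv_fejerk_mean] this
    convolution is close to (A + iB)(c + is). Both parts improve together because the product mixes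
    them. *)
Lemma fejerk_pair_contraction a b g d y m :
  let gc w := cos (y * w) * g w in let gs w := sin (y * w) * g w in
  let A := conv a (fejerk d) in let B := conv b (fejerk d) in
  bmeas a -> bmeas b -> L1 mu g -> 0 < d -> 0 < m ->
  0 < (\int[mu]_w gc w) ^+ 2 + (\int[mu]_w gs w) ^+ 2 ->
  8 * (\int[mu]_w (osc d w * `|g w|)) * (\int[mu]_w `|g w|) <=
    (\int[mu]_w gc w) ^+ 2 + (\int[mu]_w gs w) ^+ 2 ->
  conv A gc x - conv B gs x @[x --> +oo] --> 0 ->
  conv A gs x + conv B gc x @[x --> +oo] --> 0 ->
  (\forall x \near +oo, `|A x| <= m /\ `|B x| <= m) ->
  \forall x \near +oo, `|A x| <= 3 / 4 * m /\ `|B x| <= 3 / 4 * m.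
Proof.
move=> gc gs A B ba bb g1 d0 m0; set D := (X in 0 < X -> _) => D0 small E1 E2 AB.
have gc1 : L1 mu gc := L1_mul_cos y g1.
have gs1 : L1 mu gs := L1_mul_sin y g1.
have bA := bmeas_conv ba (L1_fejerk d0).
have bB := bmeas_conv bb (L1_fejerk d0).
have v1 := L1_abs (L1_vpk d0); have ag1 := L1_abs g1.
(* One error function for both parts, so that the same remainder [r] bounds all four
   approximations. *)
pose e x := Num.max (`|A x| - m) 0 + Num.max (`|B x| - m) 0.
have be : bmeas e by apply: bmeasD; exact: bmeas_excess.
have e_ge0 x : 0 <= e x by rewrite addr_ge0// le_max lexx orbT.
have e0 : e x @[x --> +oo] --> 0.
  rewrite -[X in _ --> X](addr0 0); apply: cvgD; apply: excess_cvg0.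
    by move: AB; apply: filterS => x [].
  by move: AB; apply: filterS => x [].
have Ae x : `|A x| <= m + e x.
  have : `|A x| - m <= Num.max (`|A x| - m) 0 by rewrite le_max lexx.
  have : 0 <= Num.max (`|B x| - m) 0 by rewrite le_max lexx orbT.
  by rewrite /e; lra.
have Be x : `|B x| <= m + e x.
  have : `|B x| - m <= Num.max (`|B x| - m) 0 by rewrite le_max lexx.
  have : 0 <= Num.max (`|A x| - m) 0 by rewrite le_max lexx orbT.
  by rewrite /e; lra.
set G := (\int[mu]_w `|g w|) in small *.
set Om := (\int[mu]_w (osc d w * `|g w|)) in small *.
pose V v := `|vpk d v : R|.
pose r x := G * conv e V x + conv (conv e V) (fun w => `|g w|) x.
have eV0 := conv_cvg0 be v1 e0.
have r0 : r x @[x --> +oo] --> 0.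
  rewrite -[X in _ --> X](addr0 0) -{1}[X in _ --> X + _](mulr0 G).
  apply: cvgD; first by apply: cvgM; [exact: cvg_cst|exact: eV0].
  by apply: conv_cvg0 => //; exact: bmeas_conv.
have G0 : 0 <= G by apply: Rintegral_ge0.
have cg w : `|gc w| <= `|g w| by rewrite normrM ler_piMl// cos_max.
have sg w : `|gs w| <= `|g w| by rewrite normrM ler_piMl// sin_max.
have hAc x := conv_fejerk_mean x ba be e_ge0 d0 g1 gc1 cg Ae.
have hAs x := conv_fejerk_mean x ba be e_ge0 d0 g1 gs1 sg Ae.
have hBc x := conv_fejerk_mean x bb be e_ge0 d0 g1 gc1 cg Be.
have hBs x := conv_fejerk_mean x bb be e_ge0 d0 g1 gs1 sg Be.
have bound k : (forall w, `|k w| <= `|g w|) -> L1 mu k -> `|\int[mu]_w k w| <= G.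
  by move=> kg k1; apply: Rint_le => //; exact: L1_meas k1.
have Gc := bound _ cg gc1; have Gs := bound _ sg gs1.
set c := (\int[mu]_w gc w) in D D0 small Gc hAc hBc.
set s := (\int[mu]_w gs w) in D D0 small Gs hAs hBs.
pose eta := D * m / (4 * (6 * G + 1)).
have G6 : 0 < 4 * (6 * G + 1) by lra.
have eta0 : 0 < eta by rewrite divr_gt0// mulr_gt0.
have etaE : eta * (4 * (6 * G + 1)) = D * m by rewrite divfK ?gt_eqF.
near=> x.
have r_x : `|r x| <= eta by near: x; exact: cvgr0_norm_le.
have E1x : `|conv A gc x - conv B gs x| <= eta by near: x; exact: cvgr0_norm_le.
have E2x : `|conv A gs x + conv B gc x| <= eta by near: x; exact: cvgr0_norm_le.
have rx : r x <= eta by exact: le_trans (ler_norm _) r_x.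
have three K : K <= m * Om + eta -> 2 * K + eta <= 2 * (m * Om) + 3 * eta.
  by clear; lra.
have le_r : m * Om + r x <= m * Om + eta by rewrite lerD2l.
have S1 : `|A x * c - B x * s| <= 2 * (m * Om) + 3 * eta.
  apply: le_trans (three _ le_r).
  apply: (@ler_norm_pair _ (conv A gc x) _ (- conv B gs x));
    [exact: hAc| |exact: E1x].
  by rewrite -normrN opprB opprK addrC; exact: hBs.
have S2 : `|A x * s + B x * c| <= 2 * (m * Om) + 3 * eta.
  exact: le_trans (ler_norm_pair (hAs x) (hBc x) E2x) (three _ le_r).
(* Division by c + is, written as multiplication by its conjugate; [D] is its squared modulus. *)
have AD : A x * D = (A x * c - B x * s) * c + (A x * s + B x * c) * s.
  by rewrite /D; ring.
have BD : B x * D = (A x * s + B x * c) * c + (- (A x * c - B x * s)) * s.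
  by rewrite /D; ring.
split; first exact: contraction_bound G0 D0 m0 Gc Gs small etaE eta0 AD S1 S2.
apply: (contraction_bound G0 D0 m0 Gc Gs small etaE eta0 BD S2).
by rewrite normrN.
Unshelve. all: end_near. Qed.

Lemma geometric_decay (P : R -> Prop) (b : R) : 0 < b -> P b ->
  (forall m, 0 < m -> P m -> P (3 / 4 * m)) ->
  forall eta, 0 < eta -> exists2 m, m <= eta & P m.
Proof.
move=> b0 Pb step eta eta0.
have h j : P (b * (3 / 4) ^+ j).
  elim: j => [|j IH]; first by rewrite expr0 mulr1.
  rewrite exprS mulrCA; apply: step => //.
  by rewrite mulr_gt0// exprn_gt0//; lra.
have : b * (3 / 4) ^+ j @[j --> \oo] --> 0.
  have := @cvg_geometric R b (3 / 4).
  by apply; rewrite ger0_norm; lra.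
move/cvgr0_norm_le => /(_ _ eta0)[j _ /(_ j (leqnn j)) hj].
by exists (b * (3 / 4) ^+ j) => //; rewrite (le_trans _ hj)// ler_norm.
Qed.

Lemma bmeas_mul_cos f y : bmeas f -> bmeas (fun x => cos (y * x) * f x).
Proof.
move=> bf; apply: bmeasM => //; split; last by exists 1 => x; exact: cos_max.
by under eq_fun do rewrite mulrC; exact: measurable_cosM.
Qed.

Lemma bmeas_mul_sin f y : bmeas f -> bmeas (fun x => sin (y * x) * f x).
Proof.
move=> bf; apply: bmeasM => //; split; last by exists 1 => x; exact: sin_max.
by under eq_fun do rewrite mulrC; exact: measurable_sinM.
Qed.

Lemma cvg0_mul_bounded f g M : (forall x, `|g x| <= M) ->
  f x @[x --> +oo] --> 0 -> g x * f x @[x --> +oo] --> 0.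
Proof.
move=> gM f0; apply/cvgr0Pnorm_le => eps eps0.
have M0 := le_trans (normr_ge0 _) (gM 0).
have e0 : 0 < eps / (M + 1) by rewrite divr_gt0//; lra.
move/cvgr0Pnorm_le : f0 => /(_ _ e0); apply: filterS => x hx.
rewrite normrM (le_trans (ler_pM _ _ (gM x) hx))//.
by rewrite mulrA ler_pdivrMr; nra.
Qed.

(* With [a + i b = f e^(iyx)], the hypothesis on [conv f g] says that the
   convolution of [a + i b] with [g e^(iyx)] vanishes at infinity. *)
Lemma local_wiener f g d y : bmeas f -> L1 mu g -> 0 < d ->
  conv f g x @[x --> +oo] --> 0 ->
  0 < (\int[mu]_w (cos (y * w) * g w)) ^+ 2
      + (\int[mu]_w (sin (y * w) * g w)) ^+ 2 ->
  8 * (\int[mu]_w (osc d w * `|g w|)) * (\int[mu]_w `|g w|) <=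
    (\int[mu]_w (cos (y * w) * g w)) ^+ 2
    + (\int[mu]_w (sin (y * w) * g w)) ^+ 2 ->
  conv f (fun v => cos (y * v) * fejerk d v) x @[x --> +oo] --> 0.
Proof.
move=> bf g1 d0 fg0 D0 small.
have f1 := L1_fejerk d0.
pose a x := cos (y * x) * f x; pose b x := sin (y * x) * f x.
have ba : bmeas a := bmeas_mul_cos y bf.
have bb : bmeas b := bmeas_mul_sin y bf.
have gc1 := L1_mul_cos y g1; have gs1 := L1_mul_sin y g1.
set A := conv a (fejerk d); set B := conv b (fejerk d).
have bfg : bmeas (conv f g) := bmeas_conv bf g1.
(* The convolution of f e^(iy.) with g e^(iy.) is e^(iyx) times [conv f g], which tends to 0.
   [conv_comm] brings the Fejer kernel outside; E1 is the real part and E2 the imaginary part. *)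
have E1 : conv A (fun w => cos (y * w) * g w) x -
    conv B (fun w => sin (y * w) * g w) x @[x --> +oo] --> 0.
  rewrite (_ : (fun x => _) = conv (fun u => cos (y * u) * conv f g u) (fejerk d)).
    apply: conv_cvg0 => //; first exact: bmeas_mul_cos.
    by apply: (@cvg0_mul_bounded _ _ 1) => // x; exact: cos_max.
  apply/funext => x; rewrite !(conv_comm x _ f1)//.
  rewrite /conv -RintB; [|exact: L1_conv (bmeas_conv _ _) f1..].
  apply: eq_Rintegral => v _; rewrite -mulrBl; congr (_ * _).
  have h1 := L1_conv (x - v) ba gc1; have h2 := L1_conv (x - v) bb gs1.
  rewrite -(RintB h1 h2) -(RintZl _ (L1_conv (x - v) bf g1)).
  apply: eq_Rintegral => w _; rewrite /a /b.
  have -> : y * (x - v) = y * (x - v - w) + y * w by ring.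
  by rewrite cosD; ring.
have E2 : conv A (fun w => sin (y * w) * g w) x +
    conv B (fun w => cos (y * w) * g w) x @[x --> +oo] --> 0.
  rewrite (_ : (fun x => _) = conv (fun u => sin (y * u) * conv f g u) (fejerk d)).
    apply: conv_cvg0 => //; first exact: bmeas_mul_sin.
    by apply: (@cvg0_mul_bounded _ _ 1) => // x; exact: sin_max.
  apply/funext => x; rewrite !(conv_comm x _ f1)//.
  rewrite /conv -RintD; [|exact: L1_conv (bmeas_conv _ _) f1..].
  apply: eq_Rintegral => v _; rewrite -mulrDl; congr (_ * _).
  have h1 := L1_conv (x - v) ba gs1; have h2 := L1_conv (x - v) bb gc1.
  rewrite -(RintD h1 h2) -(RintZl _ (L1_conv (x - v) bf g1)).
  apply: eq_Rintegral => w _; rewrite /a /b.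
  have -> : y * (x - v) = y * (x - v - w) + y * w by ring.
  by rewrite sinD; ring.
have bA : bmeas A := bmeas_conv ba f1.
have bB : bmeas B := bmeas_conv bb f1.
have AB eta : 0 < eta -> \forall x \near +oo, `|A x| <= eta /\ `|B x| <= eta.
  move=> eta0; have [[_ [M1 hM1]] [_ [M2 hM2]]] := (bA, bB).
  have M10 := le_trans (normr_ge0 _) (hM1 0).
  have M20 := le_trans (normr_ge0 _) (hM2 0).
  have [||m m0 Pm|m me] := @geometric_decay
    (fun m => \forall x \near +oo, `|A x| <= m /\ `|B x| <= m) (M1 + M2 + 1) _ _ _
    eta eta0.
  - lra.
  - apply: nearW => x; have := hM1 x; have := hM2 x => h1 h2; split; lra.
  - exact: (fejerk_pair_contraction ba bb g1 d0 m0 D0 small E1 E2 Pm).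
  by apply: filterS => x [h1 h2]; split; exact: le_trans me.
have A0 : A x @[x --> +oo] --> 0.
  by apply/cvgr0Pnorm_le => eta /AB; apply: filterS => x [].
have B0 : B x @[x --> +oo] --> 0.
  by apply/cvgr0Pnorm_le => eta /AB; apply: filterS => x [].
(* Undoing the modulation: the convolution sought is the real part of e^(-iyx) (A + iB). *)
rewrite (_ : conv f _ = (fun x => cos (y * x) * A x + sin (y * x) * B x)).
  rewrite -[X in _ --> X](addr0 0); apply: cvgD.
    by apply: (@cvg0_mul_bounded _ _ 1) => // x; exact: cos_max.
  by apply: (@cvg0_mul_bounded _ _ 1) => // x; exact: sin_max.
apply/funext => x; have h1 := L1_conv x ba f1; have h2 := L1_conv x bb f1.
rewrite /A /B /conv -(RintZl _ h1) -(RintZl _ h2).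
rewrite -(RintD (L1_Z _ h1) (L1_Z _ h2)); apply: eq_Rintegral => v _.
have -> : y * v = y * x - y * (x - v) by ring.
by rewrite cosB /a /b; ring.
Qed.

End local_tauberian.

(** * From single frequencies to Fejer kernels of every bandwidth *)

Section wiener_tauberian.
Context (R : realType).
Notation mu := (@lebesgue_measure R).
Implicit Types (f g k : R -> R) (d m x y : R).

(** The inner sums are Dirichlet kernels; 1 - cos x times the j-th one is cos (j x) - cos ((j + 1)
    x), and these telescope. *)
Lemma fejer_trig_sum (N : nat) x :
  (1 - cos x) * (\sum_(j < N) (1 + \sum_(i < j) 2 * cos (i.+1%:R * x))) =
  1 - cos (N%:R * x).
Proof.
have D j : (1 - cos x) * (1 + \sum_(i < j) 2 * cos (i.+1%:R * x)) =
    cos (j%:R * x) - cos (j.+1%:R * x).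
  elim: j => [|j IH]; first by rewrite big_ord0 mul0r cos0 mul1r addr0 mulr1.
  rewrite big_ord_recr /= addrA mulrDr IH.
  have -> : j%:R * x = j.+1%:R * x - x by rewrite -natr1; ring.
  have -> : j.+2%:R * x = j.+1%:R * x + x by rewrite -natr1; ring.
  by rewrite cosB cosD; ring.
elim: N => [|N IH]; first by rewrite big_ord0 mulr0 mul0r cos0 subrr.
by rewrite big_ord_recr /= mulrDr IH D; ring.
Qed.

(** The value of the trigonometric sum at 0, where 1 - cos x cannot be cancelled: the first [N] odd
    numbers add up to a square. *)
Lemma fejer_sum_odd (N : nat) :
  \sum_(j < N) (1 + \sum_(i < j) (2 : R)) = N%:R ^+ 2.
Proof.
elim: N => [|N IH]; first by rewrite big_ord0 expr0n.
rewrite big_ord_recr /= IH sumr_const card_ord -[RHS]/(N.+1%:R ^+ 2) -natr1.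
by rewrite -mulr_natr; ring.
Qed.

(* The Fejer kernel of bandwidth [N d] as a trigonometric polynomial times the
   kernel of bandwidth [d]. *)
Lemma fejerk_refine (N : nat) d x : (0 < N)%N -> d != 0 ->
  fejerk (N%:R * d) x = N%:R^-1 *
    (\sum_(j < N) (1 + \sum_(i < j) 2 * cos (i.+1%:R * d * x))) * fejerk d x.
Proof.
move=> N0 d0; have N0' : N%:R != 0 :> R by rewrite pnatr_eq0 -lt0n.
rewrite /fejerk; have [->|x0] := eqVneq x 0.
  under eq_bigr do under eq_bigr do rewrite mulr0 cos0 mulr1.
  by rewrite fejer_sum_odd !mulr0; field; rewrite N0' gt_eqF ?fejer_mass_gt0.
have dx0 : d * x != 0 by rewrite mulf_neq0.
have Ndx0 : N%:R * d * x != 0 by rewrite -mulrA mulf_neq0.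
rewrite !fejer_eq// -[N%:R * d * x]mulrA -fejer_trig_sum.
under [in RHS]eq_bigr do under eq_bigr do rewrite -mulrA.
by field; rewrite N0' x0 d0 gt_eqF ?fejer_mass_gt0.
Qed.

(** Integrability is bundled in so that these kernels form a linear space, in which the
    trigonometric expansion is assembled term by term. *)
Definition conv_vanishes f k := L1 mu k /\ conv f k x @[x --> +oo] --> 0.

Lemma conv_vanishesD f k1 k2 : bmeas f -> conv_vanishes f k1 ->
  conv_vanishes f k2 -> conv_vanishes f (fun x => k1 x + k2 x).
Proof.
move=> bf [L1k1 h1] [L1k2 h2]; split; first exact: L1_D.
rewrite (_ : conv f _ = fun x => conv f k1 x + conv f k2 x).
  by rewrite -[X in _ --> X](addr0 0); exact: cvgD.
apply/funext => x; rewrite /conv -(RintD (L1_conv x bf L1k1) (L1_conv x bf L1k2)).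
by apply: eq_Rintegral => v _; rewrite mulrDr.
Qed.

Lemma conv_vanishesZ f k (c : R) : bmeas f -> conv_vanishes f k ->
  conv_vanishes f (fun x => c * k x).
Proof.
move=> bf [k1 h]; split; first exact: L1_Z.
rewrite (_ : conv f _ = fun x => c * conv f k x).
  by rewrite -[X in _ --> X](mulr0 c); apply: cvgM => //; exact: cvg_cst.
apply/funext => x; rewrite /conv -(RintZl _ (L1_conv x bf k1)).
by apply: eq_Rintegral => v _; rewrite mulrCA.
Qed.

Lemma conv_vanishes_sum f (I : Type) (s : seq I) (F : I -> R -> R) : bmeas f ->
  (forall i, conv_vanishes f (F i)) ->
  conv_vanishes f (fun x => \sum_(i <- s) F i x).
Proof.
move=> bf hF; elim: s => [|i s IH].
  split; first by under [X in L1 _ X]eq_fun do rewrite big_nil; exact: integrable0.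
  apply: cvg_near_cst; apply: nearW => x; rewrite -[RHS](Rint0 mu).
  by apply: eq_Rintegral => v _; rewrite big_nil mulr0.
rewrite (_ : (fun x => _) = fun x => F i x + \sum_(i <- s) F i x).
  exact: conv_vanishesD.
by apply/funext => x; rewrite big_cons.
Qed.

(** Choosing [d = Lam / N.+1] makes [fejerk Lam] a combination of [fejerk d] modulated by multiples
    of [d] in [0, Lam]. Each term vanishes by [local_wiener], provided the same [d] is small enough
    for all these frequencies. *)
Theorem wiener_fejer f g (Lam : R) : bmeas f -> L1 mu g ->
  (forall y, 0 < (\int[mu]_w (cos (y * w) * g w)) ^+ 2
                 + (\int[mu]_w (sin (y * w) * g w)) ^+ 2) ->
  conv f g x @[x --> +oo] --> 0 -> 0 < Lam ->
  conv f (fejerk Lam) x @[x --> +oo] --> 0.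
Proof.
move=> bf g1 hat_g fg0 L0.
pose D y := (\int[mu]_w (cos (y * w) * g w)) ^+ 2
            + (\int[mu]_w (sin (y * w) * g w)) ^+ 2.
have ag1 := L1_abs g1.
have cD : continuous D.
  have cc : continuous (fun y => \int[mu]_w (cos (y * w) * g w)).
    apply: (continuous_dct _ ag1).
    - by move=> y; exact: L1_meas (L1_mul_cos y g1).
    - by move=> y w; rewrite normrM ler_piMl// cos_max.
    - by move=> w y; apply: cvgM; [exact: continuous_cosM|exact: cvg_cst].
  have cs : continuous (fun y => \int[mu]_w (sin (y * w) * g w)).
    apply: (continuous_dct _ ag1).
    - by move=> y; exact: L1_meas (L1_mul_sin y g1).
    - by move=> y w; rewrite normrM ler_piMl// sin_max.
    - by move=> w y; apply: cvgM; [exact: continuous_sinM|exact: cvg_cst].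
  by move=> y; exact: (cvgD (cvgM (cc y) (cc y)) (cvgM (cs y) (cs y))).
(* Compactness of [0, Lam] bounds the squared modulus of the transform below by a positive
   constant. *)
have [y0 _ Dmin] := EVT_min (ltW L0) (continuous_subspaceT cD).
set G := \int[mu]_w `|g w|.
have G0 : 0 <= G by apply: Rintegral_ge0.
have e0 : Lam / n.+1%:R @[n --> \oo] --> 0.
  rewrite -[X in _ --> X](mulr0 Lam); apply: cvgM; first exact: cvg_cst.
  exact: cvg_harmonic.
(* With this threshold 8 Om G is at most [D y0]; G + 1 replaces G to avoid a zero denominator. *)
have eps0 : 0 < D y0 / (8 * (G + 1)).
  by rewrite divr_gt0 ?hat_g// mulr_gt0//; lra.
have /cvgr0Pnorm_le/(_ _ eps0)[N _ /(_ N (leqnn N)) hN] := osc_integral_cvg0 g1 e0.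
pose d := Lam / N.+1%:R; have d0 : 0 < d by rewrite divr_gt0.
have small y : y \in `[0, Lam] ->
    8 * (\int[mu]_w (osc d w * `|g w|)) * G <= D y.
  move=> yL; apply: le_trans (Dmin _ yL).
  have -> : \int[mu]_w (osc d w * `|g w|) =
      \int[mu]_w (osc 1 (w * (Lam / N.+1%:R)) * `|g w|).
    by apply: eq_Rintegral => w _; rewrite osc_scale.
  have := le_trans (ler_norm _) hN; set Om := (\int[mu]_w _) => hOm.
  rewrite ler_pdivlMr in hOm; last by rewrite mulr_gt0//; lra.
  have Om0 : 0 <= Om.
    by apply: Rintegral_ge0 => w _; apply: mulr_ge0 => //; exact: osc_ge0.
  apply: le_trans hOm; nra.
have loc y : y \in `[0, Lam] ->
    conv_vanishes f (fun v => cos (y * v) * fejerk d v).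
  move=> yL; split; first exact/L1_mul_cos/L1_fejerk.
  exact: (local_wiener bf g1 d0 fg0 (hat_g y) (small y yL)).
suff : conv_vanishes f (fejerk Lam) by case.
(* The constant term of the trigonometric polynomial is written as frequency 0, so that [loc] covers
   every summand. *)
have -> : fejerk Lam = fun v => N.+1%:R^-1 * (\sum_(j < N.+1)
    (cos (0 * v) * fejerk d v +
     \sum_(i < j) 2 * (cos (i.+1%:R * d * v) * fejerk d v))).
  apply/funext => v; have -> : Lam = N.+1%:R * d by rewrite mulrC divfK.
  rewrite fejerk_refine ?gt_eqF// -mulrA mulr_suml; congr (_ * _).
  apply: eq_bigr => j _; rewrite mul0r cos0 mulrDl; congr (_ + _).
  by rewrite mulr_suml; apply: eq_bigr => i _; rewrite !mulrA.
apply: conv_vanishesZ => //; apply: conv_vanishes_sum => // j.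
apply: conv_vanishesD => //.
  by apply: loc; rewrite in_itv /= lexx ltW.
apply: conv_vanishes_sum => // i; apply: conv_vanishesZ => //; apply: loc.
rewrite in_itv /= mulr_ge0 1?(ltW d0)//= /d mulrCA ler_piMr 1?(ltW L0)//.
by rewrite ler_pdivrMr// mul1r ler_nat (leq_trans (ltn_ord i))// ltnW.
Qed.

End wiener_tauberian.

(** * Slowly decreasing functions *)

Section slow_decrease.
Context (R : realType).
Notation mu := (@lebesgue_measure R).
Implicit Types (f : R -> R) (x u eta : R).

Lemma fejerk_ge0 d u : 0 < d -> 0 <= fejerk d u :> R.
Proof.
move=> d0; apply: mulr_ge0; last exact: fejer_ge0.
by apply: divr_ge0; apply: ltW => //; exact: fejer_mass_gt0.
Qed.

Lemma fejerk_mass d : 0 < d -> \int[mu]_u fejerk d u = 1.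
Proof.
move=> d0; have := @fejerk_transform _ d 0 d0.
rewrite lexx ltW// mul0r subr0 => <- //.
by apply: eq_Rintegral => u _; rewrite mul0r cos0 mul1r.
Qed.

Definition fejerk_tail eta d : R :=
  \int[mu]_u ((1 - \1_`[- eta, eta] u) * fejerk d u).

Lemma compl_itv_le1 eta u : `|1 - \1_`[- eta, eta] u| <= 1 :> R.
Proof. by rewrite indicE; case: (_ \in _); rewrite ?subrr ?subr0 ?normr0 ?normr1. Qed.

Lemma measurable_compl_itv eta :
  measurable_fun setT (fun u : R => 1 - \1_`[- eta, eta] u : R).
Proof. exact: measurable_funB. Qed.

Lemma L1_fejerk_tail eta d : 0 < d ->
  L1 mu (fun u => (1 - \1_`[- eta, eta] u) * fejerk d u).
Proof.
move=> d0; apply: (@L1_bounded_mul _ _ _ _ _ _ 1); last exact: L1_fejerk.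
  exact: measurable_compl_itv.
by move=> u; exact: compl_itv_le1.
Qed.

(** Rescaling fixes the kernel and moves the cut-off instead: the tail becomes that of [fejerk 1]
    beyond n.+1 times [eta]. *)
Lemma fejerk_tail_cvg0 eta : 0 < eta ->
  fejerk_tail eta n.+1%:R @[n --> \oo] --> 0.
Proof.
move=> eta0; pose F (n : nat) (v : R) :=
  (1 - \1_`[- eta, eta] (n.+1%:R^-1 * v)) * fejerk 1 v.
have F1 n : L1 mu (F n).
  apply: (@L1_bounded_mul _ _ _ _ _ _ 1); last exact: L1_fejerk.
    apply: (measurableT_comp (measurable_compl_itv eta)).
    exact: measurable_funM.
  by move=> u; exact: compl_itv_le1.
have -> : (fun n : nat => fejerk_tail eta n.+1%:R) =
    fun n => \int[mu]_v F n v.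
  apply/funext => n; have n0 : n.+1%:R != 0 :> R by rewrite pnatr_eq0.
  rewrite (Rintegral_affine 0 n0 (F1 n)) ger0_norm//.
  rewrite -(RintZl _ (L1_affine 0 n0 (F1 n))).
  apply: eq_Rintegral => u _; rewrite /F /fejerk addr0 mulKf//.
  by have -> : 1 * (n.+1%:R * u) = n.+1%:R * u; ring.
rewrite -[X in _ --> X](Rint0 mu).
apply: (@dct_seq _ _ _ mu F (cst 0) (fejerk 1)).
- by move=> n; exact: L1_meas (F1 n).
- exact: (@measurable_cst _ _ _ _ setT (0 : R)).
- exact: L1_fejerk.
- move=> n v; have f0 := @fejerk_ge0 1 v ltr01.
  by rewrite normrM [X in _ * X]ger0_norm// ler_piMl// compl_itv_le1.
move=> v; apply: cvg_near_cst.
have : n.+1%:R^-1 * v @[n --> \oo] --> 0 * v.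
  by apply: cvgM; [exact: cvg_harmonic|exact: cvg_cst].
rewrite mul0r => /cvgr0Pnorm_le /(_ _ eta0); apply: filterS => n hn.
by rewrite /F indicE mem_set ?subrr ?mul0r//= in_itv /= -ler_norml.
Qed.

Section one_scale.
Variables (f : R -> R) (c M eta d : R).
Hypotheses (bf : bmeas f) (f0 : forall x, 0 <= f x) (fM : forall x, f x <= M).
Hypotheses (c0 : 0 <= c) (eta0 : 0 < eta) (d0 : 0 < d).
Hypothesis f_slow : forall x s, 0 <= s -> f (x + s) <= expR (c * s) * f x.

Let kappa := expR (c * (2 * eta)).

Let slow x s : 0 <= s <= 2 * eta -> f (x + s) <= kappa * f x.
Proof.
move=> /andP[s0 s1]; apply: (le_trans (f_slow x s0)).
by apply: ler_wpM2r => //; rewrite ler_expR; exact: ler_wpM2l.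
Qed.

(** For |u| at most [eta] the point [x - eta - u] lies at most [2 * eta] to the left of [x], so
    [f x] is at most [kappa] times the value there. Averaging over [u] leaves only the tail, where
    [f] is bounded by [M]. *)
Lemma slow_decrease_upper x :
  f x <= kappa * conv f (fejerk d) (x - eta) + M * fejerk_tail eta d.
Proof.
have h1 := L1_conv (x - eta) bf (L1_fejerk d0).
have h2 := L1_fejerk_tail eta d0.
rewrite -[leLHS]mulr1 -(fejerk_mass d0) -(RintZl _ (L1_fejerk d0)).
rewrite /conv /fejerk_tail -(RintZl _ h1) -(RintZl _ h2).
rewrite -(RintD (L1_Z _ h1) (L1_Z _ h2)).
apply: le_Rintegral => //.
- exact: L1_Z (L1_fejerk d0).
- exact: L1_D (L1_Z _ h1) (L1_Z _ h2).
move=> u _; rewrite [kappa * (_ * _)]mulrA [M * (_ * _)]mulrA -mulrDl;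
  apply: ler_wpM2r; first exact: fejerk_ge0.
rewrite indicE; case: (boolP (u \in _)) => [|_].
  rewrite inE /= in_itv /= => /andP[u0 u1].
  rewrite subrr mulr0 addr0 -[x in leLHS](_ : (x - eta - u) + (eta + u) = x).
    by apply: slow; apply/andP; split; lra.
  by ring.
by rewrite subr0 mulr1 (le_trans (fM x))// lerDr mulr_ge0// expR_ge0.
Qed.

(** The mirror argument: centred at [x + eta], the sampled points lie at most [2 * eta] to the right
    of [x]. *)
Lemma slow_decrease_lower x :
  conv f (fejerk d) (x + eta) <= kappa * f x + M * fejerk_tail eta d.
Proof.
have h1 := L1_conv (x + eta) bf (L1_fejerk d0).
have h2 := L1_fejerk_tail eta d0.
rewrite -[kappa * f x]mulr1 -(fejerk_mass d0) -(RintZl _ (L1_fejerk d0)).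
rewrite /conv /fejerk_tail -(RintZl _ h2).
rewrite -(RintD (L1_Z _ (L1_fejerk d0)) (L1_Z _ h2)).
apply: le_Rintegral => //.
- exact: L1_D (L1_Z _ (L1_fejerk d0)) (L1_Z _ h2).
move=> u _; rewrite [M * (_ * _)]mulrA -mulrDl;
  apply: ler_wpM2r; first exact: fejerk_ge0.
rewrite indicE; case: (boolP (u \in _)) => [|_].
  rewrite inE /= in_itv /= => /andP[u0 u1].
  rewrite subrr mulr0 addr0 (_ : x + eta - u = x + (eta - u)); last by ring.
  by apply: slow; apply/andP; split; lra.
by rewrite subr0 mulr1 (le_trans (fM _))// lerDr mulr_ge0// expR_ge0.
Qed.

End one_scale.

(** The Fejer means at [x - eta] and [x + eta] squeeze [f x] up to the factor [kappa] and the tail.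
    First [eta] makes [kappa] close to 1, then a large bandwidth makes the tail small, and only then
    does [x] tend to +oo. *)
Theorem slow_decrease_tauberian f (c l : R) : bmeas f -> (forall x, 0 <= f x) ->
  0 <= c -> (forall x s, 0 <= s -> f (x + s) <= expR (c * s) * f x) ->
  (forall d, 0 < d -> conv (fun x => f x - l) (fejerk d) x @[x --> +oo] --> 0) ->
  f x @[x --> +oo] --> l.
Proof.
move=> bf f0 c0 f_slow lim.
have [M M0 fM] : exists2 M, 0 <= M & forall x, f x <= M.
  have [_ [M hM]] := bf; exists M; first exact: le_trans (normr_ge0 _) (hM 0).
  by move=> x; exact: le_trans (ler_norm _) (hM x).
have convE d x : 0 < d ->
    conv f (fejerk d) x = conv (fun x => f x - l) (fejerk d) x + l.
  move=> d0; have h1 := L1_conv x bf (L1_fejerk d0); have h2 := L1_fejerk d0.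
  rewrite /conv; under [in RHS]eq_Rintegral do rewrite mulrBl.
  by rewrite (RintB h1 (L1_Z l h2)) (RintZl _ h2) fejerk_mass// mulr1 subrK.
apply/cvgrPdist_le => eps eps0.
(* The cap 1 bounds the Fejer mean [q + l] by |l| + 1, which is what [kappa - 1] multiplies in
   [h1]. *)
pose tau := Num.min (eps / 4) 1.
have tau0 : 0 < tau by rewrite lt_min ltr01 andbT divr_gt0.
have tau1 : tau <= 1 by rewrite ge_min lexx orbT.
have tau4 : tau <= eps / 4 by rewrite ge_min lexx.
pose delta := eps / (4 * (M + `|l| + 1)).
have Ml0 : 0 < 4 * (M + `|l| + 1) by rewrite mulr_gt0// ltr_wpDl// addr_ge0.
have delta0 : 0 < delta by rewrite divr_gt0.
have deltaE : delta * (4 * (M + `|l| + 1)) = eps by rewrite divfK ?gt_eqF.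
(* This makes [kappa] at most [1 + delta]; the denominator is [2 * c + 1] because [c] may be 0. *)
pose eta := ln (1 + delta) / (2 * c + 1).
have ln0 : 0 < ln (1 + delta) by rewrite ln_gt0// ltrDl.
have eta0 : 0 < eta by rewrite divr_gt0//; lra.
have etaE : eta * (2 * c + 1) = ln (1 + delta) by rewrite divfK//; lra.
pose kappa := expR (c * (2 * eta)).
have kappa1 : kappa <= 1 + delta.
  rewrite /kappa -[leRHS]lnK ?posrE; last lra.
  by rewrite ler_expR -etaE; nra.
have kappa_ge1 : 1 <= kappa.
  by rewrite /kappa -[leLHS]expR0 ler_expR mulr_ge0// mulr_ge0// ltW.
have t0 : 0 < eps / (4 * (M + 1)) by rewrite divr_gt0// mulr_gt0//; lra.
have /cvgr0Pnorm_le /(_ _ t0)[N _ /(_ N (leqnn N)) hT] := fejerk_tail_cvg0 eta0.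
pose d : R := N.+1%:R; have d0 : 0 < d by rewrite ltr0n.
set T := fejerk_tail _ _ in hT.
have MT : M * T <= eps / 4.
  have := le_trans (ler_norm _) hT; rewrite ler_pdivlMr; last lra.
  have : 0 <= T.
    apply: Rintegral_ge0 => u _; apply: mulr_ge0; last exact: fejerk_ge0.
    by rewrite indicE; case: (_ \in _); rewrite ?subrr ?subr0.
  by clear; lra.
have := lim _ d0 => /cvgr0Pnorm_le /(_ _ tau0) [A [_ hA]].
exists (A + eta); split; first exact: num_real.
move=> x Ax; have x1 : A < x - eta by lra.
have x2 : A < x + eta by lra.
have := hA _ x1; have := hA _ x2; rewrite !ler_norml.
move=> /andP[l1 u1] /andP[l2 u2].
have := slow_decrease_upper eta bf f0 fM c0 d0 f_slow x.
have := slow_decrease_lower eta bf f0 fM c0 d0 f_slow x.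
rewrite -/kappa -/T !convE//.
set p := conv _ _ _ in l1 u1 *; set q := conv _ _ _ in l2 u2 *.
move=> lo up.
have h1 : (kappa - 1) * (q + l) <= delta * (`|l| + 1).
  have := ler_norm l => ll; apply: (@le_trans _ _ ((kappa - 1) * (`|l| + 1))).
    by apply: ler_wpM2l; lra.
  by apply: ler_wpM2r; [apply: addr_ge0|lra].
have h2 : (kappa - 1) * f x <= delta * M by apply: ler_pM => //; lra.
have h3 : delta * M + delta * (`|l| + 1) = eps / 4 by rewrite -deltaE; field.
have h4 : 0 <= delta * M by rewrite mulr_ge0// ltW.
have h5 : 0 <= delta * (`|l| + 1) by rewrite mulr_ge0 ?addr_ge0// ltW.
by apply/andP; split; lra.
Qed.

End slow_decrease.

(** * Measures given by a density *)

Section density.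
Local Open Scope ereal_scope.
Context d (T : measurableType d) (R : realType).
Variables (m2 : {measure set T -> \bar R}) (p : T -> R).
Hypotheses (mp : measurable_fun setT p) (p0 : forall x, (0 <= p x)%R).

(** The proofs of measurability and nonnegativity are arguments, so that a measure structure can be
    attached to the term. *)
Definition density_measure of measurable_fun setT p & (forall x, (0 <= p x)%R) :=
  fun A : set T => \int[m2]_(x in A) (p x)%:E.

Local Notation dm := (density_measure mp p0).

Let dm0 : dm set0 = 0.
Proof. exact: integral_set0. Qed.

Let dm_ge0 A : 0 <= dm A.
Proof. by apply: integral_ge0 => x _; rewrite lee_fin. Qed.

Let dm_sigma_additive : semi_sigma_additive dm.
Proof.
move=> F mF tF mUF; rewrite /density_measure ge0_integral_bigcup//.
- apply: is_cvg_ereal_nneg_natsum_cond => n _ _.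
  by apply: integral_ge0 => x _; rewrite lee_fin.
- by apply: measurable_funTS; exact/measurable_EFinP.
- by move=> x _; rewrite lee_fin.
Qed.

HB.instance Definition _ := isMeasure.Build _ _ _ dm dm0 dm_ge0 dm_sigma_additive.

Import HBNNSimple.

(** Monotone convergence reduces both sides to simple functions; on a level set the identity is the
    definition of the density measure. *)
Lemma ge0_integral_density (f : T -> \bar R) : measurable_fun setT f ->
  (forall x, 0 <= f x) -> \int[dm]_x f x = \int[m2]_x (f x * (p x)%:E).
Proof.
move=> mf f0; pose h := nnsfun_approx measurableT mf.
have mpE : measurable_fun setT (EFin \o p) by exact/measurable_EFinP.
have hf x : (EFin \o h n) x @[n --> \oo] --> f x.
  exact: cvg_nnsfun_approx.
have -> : \int[dm]_x f x = lim (\int[dm]_x (h n x)%:E @[n --> \oo]).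
  rewrite -monotone_convergence//.
  - by apply: eq_integral => x _; apply/esym/cvg_lim => //; exact: hf.
  - by move=> n; exact/measurable_EFinP.
  - by move=> n x _; rewrite lee_fin.
  - by move=> x _ a b ab; rewrite lee_fin; exact/lefP/nd_nnsfun_approx.
have -> : \int[m2]_x (f x * (p x)%:E) =
    lim (\int[m2]_x ((h n x)%:E * (p x)%:E) @[n --> \oo]).
  rewrite -monotone_convergence//.
  - apply: eq_integral => x _; apply/esym/cvg_lim => //.
    by apply: cvgeZr => //; exact: hf.
  - by move=> n; apply: emeasurable_funM => //; exact/measurable_EFinP.
  - by move=> n x _; rewrite mule_ge0 ?lee_fin.
  - move=> x _ a b ab; rewrite lee_wpmul2r ?lee_fin//.
    exact/lefP/nd_nnsfun_approx.
congr (lim (_ @[_ --> \oo])); apply/funext => n.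
rewrite integralT_nnsfun sintegralE.
transitivity (\int[m2]_x (\sum_(y \in range (h n))
    (y * \1_(h n @^-1` [set y]) x)%:E * (p x)%:E)); last first.
  apply: eq_integral => x _.
  rewrite -ge0_mule_fsuml => [|y]; last exact: nnfun_muleindic_ge0.
  by rewrite fsumEFin// -(fimfunE (h n) x).
rewrite ge0_integral_fsum//; last 2 first.
- move=> y; apply: emeasurable_funM => //.
  by apply/measurable_EFinP; exact: measurable_funM.
- by move=> y x _; rewrite mule_ge0 ?lee_fin// -lee_fin nnfun_muleindic_ge0.
apply: eq_fsbigr => y yr.
have y0 : (0 <= y)%R by move: yr; rewrite inE => -[x _ <-].
rewrite /= /density_measure integral_mkcond -ge0_integralZl//=.
- by apply: eq_integral => x _; rewrite EFinM -muleA epatch_indic/= [(p x)%:E * _]muleC.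
- by apply/(measurable_restrictT _ _).1 => //; exact: measurable_funTS.
- by move=> x _; rewrite patchE; case: ifP; rewrite ?lee_fin.
Qed.

End density.

(** * Balls and polar coordinates *)

Section euclidean_geometry.
Context (R : realType).
Notation mu := (@lebesgue_measure R).

Lemma measurable_affine_rV n (r : R) (b : 'rV[R]_n) :
  measurable_fun setT (fun v : 'rV[R]_n => r *: v + b).
Proof.
apply: measurable_fun_row => i; under eq_fun do rewrite !mxE.
by apply: measurable_funD => //; apply: measurable_funM => //; exact: measurable_coord.
Qed.

(** Induction on the dimension, slicing along the first coordinate: the change of variable on the
    line handles that coordinate and the induction hypothesis handles the slices. *)
Lemma lebesgue_rV_affine n (r : R) (b : 'rV[R]_n) (A : set 'rV[R]_n) :
  r != 0 -> measurable A ->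
  (lebesgue_rV n A =
   (`|r| ^+ n)%:E * lebesgue_rV n ((fun v => (r *: v + b)%R) @^-1` A))%E.
Proof.
move=> r0; elim: n b A => [|n IH] b A mA.
  rewrite expr0 mul1e /= !diracE; congr (_ %:R%:E); congr nat_of_bool.
  by apply/asboolP/asboolP; rewrite ?inE /= (_ : r *: 0 + b = 0)//;
    apply/rowP => -[].
have mcons : measurable (@cons_rV R n @^-1` A : set (measurableTypeR R * 'rV[R]_n)).
  by rewrite -[X in measurable X]setTI; exact: measurable_cons_rV.
have maff : measurable ((fun v => r *: v + b) @^-1` A).
  by rewrite -[X in measurable X]setTI; exact: measurable_affine_rV.
have mcons' : measurable (@cons_rV R n @^-1` ((fun v => r *: v + b) @^-1` A)
    : set (measurableTypeR R * 'rV[R]_n)).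
  by rewrite -[X in measurable X]setTI; exact: measurable_cons_rV.
pose F (B : set (measurableTypeR R * 'rV[R]_n)) (x : R) :=
  lebesgue_rV n (xsection B x).
have mF B : measurable B -> measurable_fun setT (F B).
  exact: (@measurable_fun_xsection _ _ (measurableTypeR R)).
have -> : lebesgue_rV n.+1 A = (\int[mu]_x F (@cons_rV R n @^-1` A) x)%E by [].
rewrite (ge0_integral_affine (b ord0 ord0) r0)//; last first.
  exact (mF _ mcons).
rewrite exprS EFinM -muleA; congr (_ * _)%E.
have -> : lebesgue_rV n.+1 ((fun v => (r *: v + b)%R) @^-1` A) =
  (\int[mu]_x F (@cons_rV R n @^-1` ((fun v => (r *: v + b)%R) @^-1` A)) x)%E.
  by [].
rewrite -ge0_integralZl; [|by []|exact (mF _ mcons')|by []|]; last first.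
  by rewrite lee_fin exprn_ge0.
apply: eq_integral => x _; rewrite /F (IH (tail_rV b)); last first.
  exact: measurable_xsection.
have consE v : cons_rV (r * x + b ord0 ord0, r *: v + tail_rV b) =
    r *: cons_rV (x, v) + b.
  apply/rowP => i; rewrite !mxE; case: (unliftP ord0 i) => [j|] -> /=.
    by rewrite !mxE.
  by [].
congr (_ * lebesgue_rV n _)%E; apply/seteqP; split=> v;
  by rewrite /preimage /xsection /= !inE /= consE.
Qed.

(** * The Euclidean norm and the volume of balls *)

Section balls.
Variable n : nat.
Implicit Types (x y : 'rV[R]_n) (r : R).

Lemma enorm_ge0 x : 0 <= enorm x. Proof. exact: sqrtr_ge0. Qed.

Lemma enorm0 : enorm (0 : 'rV[R]_n) = 0.
Proof.
by rewrite /enorm big1 ?sqrtr0// => i _; rewrite mxE expr0n.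
Qed.

Lemma enormZ r x : enorm (r *: x) = `|r| * enorm x.
Proof.
rewrite /enorm -sqrtr_sqr -sqrtrM ?sqr_ge0// mulr_sumr.
by congr Num.sqrt; apply: eq_bigr => i _; rewrite mxE exprMn.
Qed.

Lemma enormN x : enorm (- x) = enorm x.
Proof. by rewrite -scaleN1r enormZ normrN1 mul1r. Qed.

Lemma enorm_sqr x : enorm x ^+ 2 = \sum_(i < n) x ord0 i ^+ 2.
Proof. by rewrite sqr_sqrtr// sumr_ge0// => i _; exact: sqr_ge0. Qed.

Lemma enorm_eq0 x : enorm x = 0 -> x = 0.
Proof.
move=> x0; apply/rowP => i; rewrite mxE; apply/eqP; rewrite -sqrf_eq0.
have := enorm_sqr x; rewrite x0 expr0n /= => /esym/eqP.
rewrite psumr_eq0; last by move=> j _; exact: sqr_ge0.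
by move/allP => /(_ i (mem_index_enum _)).
Qed.

Lemma enorm_gt0 x : x != 0 -> 0 < enorm x.
Proof.
move=> x0; rewrite lt_neqAle enorm_ge0 andbT eq_sym.
by apply: contra_neq x0 => /enorm_eq0.
Qed.

Lemma measurable_enorm : measurable_fun setT (@enorm R n).
Proof.
apply: measurableT_comp => //.
  by apply: continuous_measurable_fun; exact: sqrt_continuous.
apply: measurable_sum => i; apply: measurable_funX; exact: measurable_coord.
Qed.

Lemma measurable_dist x : measurable_fun setT (fun y => enorm (y - x)).
Proof.
apply: (measurableT_comp measurable_enorm).
have := measurable_affine_rV 1 (- x); congr measurable_fun.
by apply/funext => v; rewrite scale1r.
Qed.

Lemma measurable_eball x r : measurable (eball x r).
Proof.
rewrite (_ : eball x r = (fun y => enorm (y - x)) @^-1` `]-oo, r[); last first.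
  by apply/seteqP; split => y; rewrite /eball /= in_itv.
by rewrite -[X in measurable X]setTI; exact: measurable_dist.
Qed.

Definition unit_ball_volume : R := fine (lebesgue_rV n (eball 0 1)).

Let box (c : R) : set 'rV[R]_n :=
  [set v | forall i, v ord0 i \in `[(const_mx (- c) : 'rV[R]_n) ord0 i,
                                    (const_mx c : 'rV[R]_n) ord0 i]].

Let measurable_box c : measurable (box c).
Proof.
have -> : box c = \bigcap_(i in [set: 'I_n])
    ((fun v : 'rV[R]_n => v ord0 i) @^-1` `[- c, c]).
  apply/seteqP; split=> v; rewrite /box /=.
    by move=> h i _; have := h i; rewrite !mxE.
  by move=> h i; rewrite !mxE; exact: h.
apply: fin_bigcap_measurable => // i _.
by rewrite -[X in measurable X]setTI; exact: measurable_coord.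
Qed.

Let box_volume c : 0 <= c -> lebesgue_rV n (box c) = ((2 * c) ^+ n)%:E.
Proof.
move=> c0; rewrite /box lebesgue_rV_box; last by move=> i; rewrite !mxE; lra.
congr EFin; rewrite (eq_bigr (fun=> 2 * c)); last by move=> i _; rewrite !mxE; ring.
by rewrite prodr_const card_ord.
Qed.

(** The volume is finite because the unit ball lies in the cube [-1, 1]^n. *)
Lemma unit_ball_volumeE : (unit_ball_volume%:E = lebesgue_rV n (eball 0 1))%E.
Proof.
rewrite /unit_ball_volume fineK// ge0_fin_numE//.
apply: (@le_lt_trans _ _ (lebesgue_rV n (box 1))).
  apply: le_measure; rewrite ?inE; [exact: measurable_eball|exact: measurable_box|].
  move=> v; rewrite /eball /= subr0 => v1 i; rewrite !mxE in_itv /= -ler_norml.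
  rewrite -(@ler_sqr R) ?nnegrE// real_normK ?num_real// expr1n.
  apply: (@le_trans _ _ (enorm v ^+ 2)).
    rewrite enorm_sqr (bigD1 i)//= lerDl sumr_ge0// => j _; exact: sqr_ge0.
  by rewrite expr_le1// ?enorm_ge0// ltW.
by rewrite box_volume// ltry.
Qed.

(** The cube of half-side 1/(n+1) fits inside: its points have squared norm at most n/(n+1). *)
Lemma unit_ball_volume_gt0 : 0 < unit_ball_volume.
Proof.
have c0 : 0 < n.+1%:R^-1 :> R by rewrite invr_gt0.
rewrite -lte_fin unit_ball_volumeE.
apply: (@lt_le_trans _ _ (lebesgue_rV n (box n.+1%:R^-1))).
  by rewrite box_volume 1?ltW// lte_fin exprn_gt0// mulr_gt0.
apply: le_measure; rewrite ?inE; [exact: measurable_box|exact: measurable_eball|].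
move=> v vbox; rewrite /eball /= subr0.
rewrite -(@ltr_sqr R) ?nnegrE ?enorm_ge0// expr1n enorm_sqr.
apply: (@le_lt_trans _ _ (\sum_(i < n) (n.+1%:R^-1 : R))).
  apply: ler_sum => i _; have := vbox i; rewrite !mxE in_itv /= -ler_norml => vi.
  rewrite -real_normK ?num_real// expr2 -[leRHS]mulr1 ler_pM//.
  by rewrite (le_trans vi)// invf_le1// ler1n.
rewrite sumr_const card_ord -[_ *+ n]mulr_natl ltr_pdivrMr// mul1r ltr_nat//.
Qed.

Lemma lebesgue_rV_eball x r : 0 < r ->
  (lebesgue_rV n (eball x r) = (unit_ball_volume * r ^+ n)%:E)%E.
Proof.
move=> r0; rewrite (lebesgue_rV_affine x (lt0r_neq0 r0) (measurable_eball x r)).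
rewrite gtr0_norm// mulrC EFinM unit_ball_volumeE.
congr (_ * lebesgue_rV n _)%E; apply/seteqP.
split => y; rewrite /eball /preimage /= addrK subr0 enormZ gtr0_norm// -ltr_pdivlMl//;
by rewrite mulVf ?gt_eqF.
Qed.

End balls.

Lemma measurable_expRM (c : R) : measurable_fun setT (fun x : R => expR (c * x)).
Proof. by apply: (measurableT_comp (@measurable_expR R)); exact: measurable_funM. Qed.

Lemma integral_exp_ray (c b : R) : 0 < c ->
  (\int[mu]_(x in `]-oo, b[) (expR (c * x))%:E = (expR (c * b) / c)%:E)%E.
Proof.
move=> c0.
have mexp : measurable_fun [set: R] (fun x => (expR (c * x))%:E).
  by apply/measurable_EFinP; exact: measurable_expRM.
rewrite integral_itv_bndo_bndc; last exact: measurable_funTS.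
(* Reflected about [b], the exponential density of rate [c] is [k] times the integrand, and it has
   integral 1. *)
set k := c * expR (- (c * b)).
have k0 : 0 < k by rewrite mulr_gt0// expR_gt0.
set I := (X in X = _).
suff : (k%:E * I = 1)%E.
  move=> kI; have -> : I = (k^-1%:E * (k%:E * I))%E.
    by rewrite muleA -EFinM mulVf ?gt_eqF// mul1e.
  by rewrite kI mule1 /k invfM -expRN opprK mulrC.
have pdfE := integral_exponential_pdf c0.
rewrite -[RHS]pdfE (@ge0_integral_affine _ (-1) b) ?oppr_eq0 ?oner_eq0//; last 2 first.
- by apply/measurable_EFinP; exact: measurable_exponential_pdf.
- by move=> x; rewrite lee_fin exponential_pdf_ge0// ltW.
rewrite normrN1 mul1e /I integral_mkcond -ge0_integralZl//; last 3 first.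
- by apply/(measurable_restrictT _ _).1 => //; exact: measurable_funTS.
- by move=> x _; rewrite patchE; case: ifP => // _; rewrite lee_fin expR_ge0.
- by rewrite lee_fin ltW.
apply: eq_integral => x _; rewrite patchE.
have [xb|xb] := leP x b.
  rewrite mem_set/= ?in_itv//= exponential_pdfE; last lra.
  by rewrite -EFinM /k -mulrA -expRD; congr (_ * expR _)%:E; ring.
rewrite memNset/= ?in_itv/= ?mule0; last by apply/negP; rewrite -ltNge.
by rewrite lt0_exponential_pdf//; lra.
Qed.

(** * Polar coordinates on the logarithmic scale *)

Section polar.
Variable n : nat.
Hypothesis n0 : (0 < n)%N.
Local Notation c := (unit_ball_volume n).

Let n0R : 0 < n%:R :> R. Proof. by rewrite ltr0n. Qed.
Let c0 : 0 < c. Proof. exact: unit_ball_volume_gt0. Qed.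

Lemma measurable_set1_rV (v : 'rV[R]_n) : measurable [set v].
Proof.
have -> : [set v] = (fun y => enorm (y - v)) @^-1` [set 0].
  apply/seteqP; split => y /= => [->|/enorm_eq0/eqP]; first by rewrite subrr enorm0.
  by rewrite subr_eq0 => /eqP.
by rewrite -[X in measurable X]setTI; exact: measurable_dist.
Qed.

Lemma lebesgue_rV_set1 (v : 'rV[R]_n) : lebesgue_rV n [set v] = 0%E.
Proof.
apply/eqP; rewrite eq_le measure_ge0 andbT; apply/lee_addgt0Pr => e e0.
(* A radius at most 1 gives r^n at most r, as the dimension is positive. *)
rewrite add0e; pose r := Num.min 1 (e / c).
have r0 : 0 < r by rewrite lt_min ltr01 divr_gt0.
apply: (@le_trans _ _ (lebesgue_rV n (eball v r))).
  apply: le_measure; rewrite ?inE; [exact: measurable_set1_rV|exact: measurable_eball|].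
  by move=> _ ->; rewrite /eball /= subrr enorm0.
rewrite lebesgue_rV_eball// lee_fin mulrC -ler_pdivlMr//.
apply: (@le_trans _ _ r); last by rewrite ge_min lexx orbT.
have r1 : r <= 1 by rewrite ge_min lexx.
by rewrite -[leRHS]expr1; apply: ler_wiXn2l => //; exact: ltW.
Qed.

(** The derivative in [w] of the volume of the ball of radius e^w. *)
Definition polar_density (w : R) : R := n%:R * c * expR (n%:R * w).

Lemma polar_density_ge0 w : 0 <= polar_density w.
Proof. by rewrite mulr_ge0 ?expR_ge0// mulr_ge0// ltW. Qed.

Lemma measurable_polar_density : measurable_fun setT polar_density.
Proof. by apply: measurable_funM => //; exact: measurable_expRM. Qed.

Let rho (x : 'rV[R]_n) : measurableTypeR R := ln (enorm x).

Lemma measurable_ln_enorm : measurable_fun setT rho.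
Proof.
by apply: (measurableT_comp (@measurable_ln R)); exact: measurable_enorm.
Qed.

Let Lam := image_measure (lebesgue_rV n) measurable_ln_enorm.
Let dens : {measure set (measurableTypeR R) -> \bar R} :=
  density_measure mu measurable_polar_density polar_density_ge0.

Let Lam_ray (b : R) : Lam `]-oo, b[%classic = (c * expR (n%:R * b))%:E.
Proof.
have -> : Lam `]-oo, b[%classic = lebesgue_rV n (rho @^-1` `]-oo, b[) by [].
have mr : measurable (rho @^-1` `]-oo, b[).
  by rewrite -[X in measurable X]setTI; exact: measurable_ln_enorm.
have m1 := measurable_set1_rV 0.
have z := lebesgue_rV_set1 0.
have me := measurable_eball (0 : 'rV[R]_n) (expR b).
(* Since [ln 0 = 0], the origin is sent to 0 instead of -oo. Adding the null set of the origin to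
   both sets makes them equal. *)
rewrite -(measureU0 mr m1 z) expRM_natl.
rewrite -(lebesgue_rV_eball (0 : 'rV[R]_n) (expR_gt0 b)).
rewrite -(measureU0 me m1 z); congr (lebesgue_rV n _).
apply/seteqP; split => x; have [->|x0] := eqVneq x 0; do ?by right.
  move=> [|/eqP]; last by rewrite (negbTE x0).
  rewrite /rho /= in_itv /= => xb; left; rewrite /eball /= subr0.
  by rewrite -[ltLHS]lnK; [rewrite ltr_expR|rewrite posrE enorm_gt0].
move=> [|/eqP]; last by rewrite (negbTE x0).
rewrite /eball /= subr0 => xb; left; rewrite /rho /= in_itv /=.
by rewrite -ltr_expR lnK// posrE enorm_gt0.
Qed.

Let dens_ray (b : R) : dens `]-oo, b[%classic = (c * expR (n%:R * b))%:E.
Proof.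
have -> : dens `]-oo, b[%classic =
  (\int[mu]_(x in `]-oo, b[) (polar_density x)%:E)%E by [].
under eq_integral do rewrite EFinM.
have mE : measurable_fun (`]-oo, b[%classic : set R) (fun x => (expR (n%:R * x))%:E).
  by apply: measurable_funTS; apply/measurable_EFinP; exact: measurable_expRM.
rewrite ge0_integralZl//; last by rewrite lee_fin mulr_ge0// ltW.
rewrite integral_exp_ray// -EFinM; congr EFin.
by field; rewrite gt_eqF.
Qed.

(** Left rays are stable under intersection, generate the Borel sets and have finite measure, so
    agreement on them suffices. *)
Lemma polar_measure (A : set (measurableTypeR R)) : measurable A ->
  Lam A = dens A.
Proof.
apply: (@measure_unique _ R (measurableTypeR R) (@RGenInftyO.G R)
  (fun k => `]-oo, k%:R[%classic) _ _ _ _ Lam dens).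
- exact: RGenInftyO.measurableE.
- move=> _ _ [x ->] [y ->]; exists (Num.min x y).
  apply/seteqP; split => z /=; rewrite !in_itv /= lt_min; first by move=> [-> ->].
  by move=> /andP.
- by move=> k; exists k%:R.
- apply/seteqP; split => // x _; have [k xk] : exists k : nat, x < k%:R.
    by exists (Num.bound `|x|); exact: le_lt_trans (ler_norm x) (archi_boundP (normr_ge0 x)).
  by exists k => //=; rewrite in_itv.
- by move=> _ [b ->]; rewrite Lam_ray dens_ray.
- by move=> k; rewrite Lam_ray ltry.
Qed.

Lemma ge0_integral_polar (F : R -> \bar R) : measurable_fun setT F ->
  (forall w, 0 <= F w)%E ->
  (\int[lebesgue_rV n]_x F (ln (enorm x)) = \int[mu]_w (F w * (polar_density w)%:E))%E.
Proof.
move=> mF F0; rewrite -(ge0_integral_density mu measurable_polar_density polar_density_ge0 mF F0).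
transitivity (\int[Lam]_w F w)%E; last first.
  by apply: eq_measure_integral => A mA _; exact: polar_measure.
have := @ge0_integral_pushforward _ _ _ (measurableTypeR R) R _ measurable_ln_enorm
  (lebesgue_rV n) setT F measurableT mF (fun y _ => F0 y).
by rewrite preimage_setT => ->.
Qed.

Lemma Rintegral_polar (H : R -> R) : measurable_fun setT H ->
  \int[lebesgue_rV n]_x H (ln (enorm x)) = \int[mu]_w (H w * polar_density w).
Proof.
move=> mH; have mHE : measurable_fun [set: R] (EFin \o H) by exact/measurable_EFinP.
rewrite /Rintegral; congr fine; rewrite integralE [in RHS]integralE.
have pE w := polar_density_ge0 w.
congr (_ - _)%E.
  have h := ge0_integral_polar (measurable_funepos mHE) (funepos_ge0 _).
  transitivity (\int[lebesgue_rV n]_x (EFin \o H)^\+%E (ln (enorm x)))%E.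
    by apply: eq_integral => x _; rewrite !funeposE.
  rewrite h; apply: eq_integral => w _; rewrite !funeposE /= (EFinM (H w)).
  by rewrite maxe_pMl ?lee_fin// mul0e.
have h := ge0_integral_polar (measurable_funeneg mHE) (funeneg_ge0 _).
transitivity (\int[lebesgue_rV n]_x (EFin \o H)^\-%E (ln (enorm x)))%E.
  by apply: eq_integral => x _; rewrite !funenegE.
rewrite h; apply: eq_integral => w _; rewrite !funenegE /= -mulNr (EFinM (- H w)).
by rewrite maxe_pMl ?lee_fin// mul0e.
Qed.

End polar.

End euclidean_geometry.

(** * The Tauberian theorem for radial means *)

Section radial_tauberian.
Context (R : realType) d (T : measurableType d).
Notation mu := (@lebesgue_measure R).
Variable m : {finite_measure set T -> \bar R}.
Variables (s : T -> R) (a : R).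
Hypotheses (ms : measurable_fun setT s) (s_ge0 : forall z, 0 <= s z) (a0 : 0 < a).
Implicit Types (H : R -> R) (x w v : R).

(** With [a = n] and [s] the distance to x0, the profile of phi gives the mean at scale e^(-x), and
    [step] gives e^(nx) times the mass of the ball of radius e^(-x). *)
Definition mellin_conv H x : R := \int[m]_z (expR (a * x) * H (s z * expR x)).

Definition step : R -> R := \1_`]-oo, 1[.

Lemma step01 u : 0 <= step u <= 1.
Proof. by rewrite /step indicE; case: (_ \in _); rewrite lexx ler01. Qed.

Lemma step_ge0 u : 0 <= step u.
Proof. by have /andP[] := step01 u. Qed.

Lemma measurable_step : measurable_fun setT step.
Proof. by apply: measurable_indic; exact: measurable_itv. Qed.

Lemma measurable_mellin_integrand H : measurable_fun setT H ->
  measurable_fun [set: measurableTypeR R * T]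
    (fun z => expR (a * z.1) * H (s z.2 * expR z.1)).
Proof.
move=> mH; apply: measurable_funM.
  by apply: measurableT_comp (measurable_expRM a) measurable_fst.
apply: (measurableT_comp mH); apply: measurable_funM.
  by apply: measurableT_comp ms measurable_snd.
by apply: measurableT_comp (@measurable_expR R) measurable_fst.
Qed.

Section bounded_profile.
Variables (H : R -> R) (B : R).
Hypotheses (mH : measurable_fun setT H) (HB : forall u, 0 <= H u <= B).

Lemma L1_cst (r : R) : L1 m (fun=> r).
Proof. exact: finite_measure_integrable_cst. Qed.

Lemma L1_mellin x : L1 m (fun z => expR (a * x) * H (s z * expR x)).
Proof.
apply: L1_Z; apply: (@L1_le _ _ _ m _ (fun=> B)); last 2 first.
- exact: L1_cst.
- by move=> z; have /andP[h0 h1] := HB (s z * expR x); rewrite ger0_norm.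
by apply: (measurableT_comp mH); exact: measurable_funM.
Qed.

Lemma mellin_conv_ge0 x : 0 <= mellin_conv H x.
Proof.
apply: Rintegral_ge0 => z _; rewrite mulr_ge0 ?expR_ge0//.
by have /andP[] := HB (s z * expR x).
Qed.

Lemma measurable_mellin_conv : measurable_fun setT (mellin_conv H).
Proof.
apply: (@measurable_Rint _ _ (measurableTypeR R) T R m
  (fun z => expR (a * z.1) * H (s z.2 * expR z.1))).
exact: measurable_mellin_integrand.
Qed.

Lemma mellin_conv_le x : mellin_conv H x <= expR (a * x) * (B * fine (m setT)).
Proof.
rewrite -Rintegral_cst// -RintZl; last exact: L1_cst.
apply: le_Rintegral => //; [exact: L1_mellin|exact/L1_Z/L1_cst|].
move=> z _; apply: ler_wpM2l; first exact: expR_ge0.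
by have /andP[] := HB (s z * expR x).
Qed.

(** The limit bounds the means beyond some [X]. Below [X] finiteness of the measure does, through
    the factor [expR (a * x)]; this is why the measure is localised. *)
Lemma bmeas_mellin_conv (L : R) : mellin_conv H x @[x --> +oo] --> L ->
  bmeas (mellin_conv H).
Proof.
move=> NL; split; first exact: measurable_mellin_conv.
have [X [_ hX]] : \forall x \near +oo, `|L - mellin_conv H x| <= 1.
  by move/cvgrPdist_le : NL; apply.
exists (`|L| + 1 + expR (a * X) * (B * fine (m setT))) => x.
have B0 : 0 <= B * fine (m setT).
  by rewrite mulr_ge0 ?fine_ge0//; have /andP[h0] := HB 0; exact: le_trans.
rewrite ger0_norm ?mellin_conv_ge0//; have [xX|Xx] := leP x X.
  rewrite (le_trans (mellin_conv_le x))// ler_wpDl ?addr_ge0//.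
  by rewrite ler_wpM2r// ler_expR ler_pM2l.
rewrite ler_wpDr//; first by apply: mulr_ge0 => //; exact: expR_ge0.
have := hX _ Xx; rewrite distrC => h; have := ler_norm (mellin_conv H x - L).
by have := ler_norm L; lra.
Qed.

End bounded_profile.

Lemma mellin_step_eq x : mellin_conv step x =
  expR (a * x) * fine (m [set z | s z < expR (- x)]).
Proof.
rewrite /mellin_conv RintZl; last first.
  apply: (@L1_le _ _ _ m _ (fun=> 1)); last 2 first.
  - exact: L1_cst.
  - by move=> z; have /andP[h0 h1] := step01 (s z * expR x); rewrite ger0_norm.
  by apply: (measurableT_comp measurable_step); exact: measurable_funM.
congr (_ * _); rewrite /Rintegral.
have -> : [set z | s z < expR (- x)] = (fun z => s z * expR x) @^-1` `]-oo, 1[.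
  have E z : (s z < expR (- x)) = (s z * expR x < 1).
    by rewrite expRN -[X in _ < X]mul1r ltr_pdivlMr ?expR_gt0.
  by apply/seteqP; split => z /=; rewrite in_itv /= E.
rewrite -[RHS]/(fine (m _)) -(setIT (_ @^-1` _)) -integral_indic//.
by rewrite -[X in measurable X]setTI; exact: measurable_funM.
Qed.

(** This is [step (expR v) * expR (a * v)], the counterpart for the unit ball of the density built
    from [H]. *)
Definition exp_ray : R -> R := fun v => \1_`]-oo, 0[ v * expR (a * v).

Lemma measurable_exp_ray : measurable_fun setT exp_ray.
Proof.
apply: measurable_funM; last exact: measurable_expRM.
by apply: measurable_indic; exact: measurable_itv.
Qed.

Lemma exp_ray_ge0 v : 0 <= exp_ray v.
Proof. by rewrite mulr_ge0 ?expR_ge0. Qed.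

Lemma integral_exp_rayE : (\int[mu]_v (exp_ray v)%:E = (a^-1)%:E)%E.
Proof.
have := integral_exp_ray 0 a0; rewrite mulr0 expR0 div1r => <-.
rewrite [RHS]integral_mkcond; apply: eq_integral => v _.
by rewrite patchE /exp_ray indicE; case: ifP; rewrite ?mul1r ?mul0r.
Qed.

Lemma L1_exp_ray : L1 mu exp_ray.
Proof.
apply/integrableP; split; first by apply/measurable_EFinP; exact: measurable_exp_ray.
under eq_integral do rewrite /comp gee0_abs ?lee_fin ?exp_ray_ge0//.
by rewrite integral_exp_rayE ltry.
Qed.

Section tauberian.
Variables (H : R -> R) (B c L : R).
Hypotheses (mH : measurable_fun setT H) (HB : forall u, 0 <= H u <= B).
Hypothesis H_decr : forall u v, 0 <= u -> u <= v -> H v <= H u.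
Hypotheses (H1 : 0 < H 1) (c0 : 0 < c).

Let g w := H (expR w) * (c * expR (a * w)).
Hypothesis g1 : L1 mu g.
Hypothesis g_mass : \int[mu]_w g w = 1.
Hypothesis g_hat : forall y, 0 < (\int[mu]_w (cos (y * w) * g w)) ^+ 2
                               + (\int[mu]_w (sin (y * w) * g w)) ^+ 2.
Hypothesis NL : mellin_conv H x @[x --> +oo] --> L.

Let N := mellin_conv H.
Let f := mellin_conv step.
Let bN : bmeas N := bmeas_mellin_conv mH HB NL.

Let g_ge0 w : 0 <= g w.
Proof.
apply: mulr_ge0; first by have /andP[] := HB (expR w).
by apply: mulr_ge0; [exact: ltW|exact: expR_ge0].
Qed.

(** Monotonicity gives that [step] is at most [H / H 1] on nonnegative arguments, so bounded means
    bound the ball masses. *)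
Let f_le x : f x <= (H 1)^-1 * N x.
Proof.
rewrite /f /N /mellin_conv -RintZl; last exact: L1_mellin mH HB _.
apply: le_Rintegral => //.
- exact: L1_mellin measurable_step step01 _.
- by apply: L1_Z; exact: L1_mellin mH HB _.
move=> z _; rewrite mulrCA; apply: ler_wpM2l; first exact: expR_ge0.
rewrite /step indicE; case: (boolP (_ \in _)) => [|_]; last first.
  apply: mulr_ge0; first by rewrite invr_ge0 ltW.
  by have /andP[] := HB (s z * expR x).
rewrite inE /= in_itv /= => h.
rewrite ler_pdivlMl// mulr1; apply: H_decr; last exact: ltW.
by rewrite mulr_ge0 ?expR_ge0.
Qed.

Let bf : bmeas f.
Proof.
split; first exact: measurable_mellin_conv measurable_step.
have [_ [M hM]] := bN; exists ((H 1)^-1 * M) => x.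
rewrite ger0_norm; last exact: mellin_conv_ge0 step01 _.
rewrite (le_trans (f_le x))// ler_pM2l ?invr_gt0//.
exact: le_trans (ler_norm _) (hM x).
Qed.

(** The balls shrink as [x] grows, so only the factor [expR (a * x)] can increase. *)
Let f_slow x u : 0 <= u -> f (x + u) <= expR (a * u) * f x.
Proof.
move=> u0; rewrite /f /mellin_conv -RintZl; last first.
  exact: L1_mellin measurable_step step01 _.
apply: le_Rintegral => //.
- exact: L1_mellin measurable_step step01 _.
- by apply: L1_Z; exact: L1_mellin measurable_step step01 _.
move=> z _; have -> : expR (a * (x + u)) = expR (a * u) * expR (a * x).
  by rewrite -expRD; congr expR; ring.
rewrite -mulrA.
apply: ler_wpM2l; first exact: expR_ge0.
apply: ler_wpM2l; first exact: expR_ge0.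
have h : s z * expR x <= s z * expR (x + u).
  by apply: ler_wpM2l => //; rewrite ler_expR lerDl.
rewrite /step !indicE; case: (boolP (s z * expR (x + u) \in _)) => // h1.
rewrite (mem_set (_ : `]-oo, 1[%classic (s z * expR x)))//.
move: h1; rewrite inE /= !in_itv /=; exact: le_lt_trans h.
Qed.

(** A mass at the centre would make [f] grow at least like [expR (a * x)], against its boundedness.
    Off this set [ln (s z)] is the true logarithm, which [inner] requires. *)
Let m_s0 : m [set z | s z = 0] = 0%E.
Proof.
have ms0 : measurable [set z | s z = 0].
  by rewrite -[X in measurable X]setTI; exact: (ms measurableT (measurable_set1 (0 : R))).
have mfin : m [set z | s z = 0] \is a fin_num by exact: fin_num_measure.
rewrite -(fineK mfin); congr EFin; apply/eqP; rewrite eq_le fine_ge0// andbT.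
have [_ [M hM]] := bf; have M0 := le_trans (normr_ge0 _) (hM 0).
apply/ler_addgt0Pr => e e0; rewrite add0r.
(* Chosen so that [expR (a * x)] equals (M + 1) / e. *)
pose x := ln ((M + 1) / e) / a.
have e1 : 0 < (M + 1) / e by rewrite divr_gt0//; lra.
have := le_trans (ler_norm _) (hM x); rewrite /f mellin_step_eq.
rewrite /x mulrCA divff ?gt_eqF// mulr1 lnK// mulrAC ler_pdivrMr//.
set p := fine _; set q := fine _ => h.
have qp : q <= p.
  have mlt : measurable [set z | s z < expR (- x)].
    rewrite (_ : [set z | _] = s @^-1` `]-oo, expR (- x)[); last first.
      by apply/seteqP; split => z /=; rewrite in_itv.
    by rewrite -[X in measurable X]setTI; exact: ms.
  apply: fine_le => //; first exact: fin_num_measure.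
  apply: le_measure; rewrite ?inE// => z /= ->; exact: expR_gt0.
have M1 : 0 < M + 1 by lra.
rewrite -(ler_pM2l M1); nra.
Qed.

(** The substitution w = x + ln (s z) - v exchanges the roles of the two profiles:
    [s z * expR (x - w)] becomes [expR v], and [expR w] becomes [s z * expR (x - v)]. *)
Let inner z x : 0 < s z ->
  (\int[mu]_w (expR (a * (x - w)) * step (s z * expR (x - w)) * g w)%:E =
   \int[mu]_v (c * (expR (a * (x - v)) * H (s z * expR (x - v)) * exp_ray v))%:E)%E.
Proof.
move=> sz0.
have meas (K : R -> R) : measurable_fun setT K ->
    measurable_fun setT (fun u : R => expR (a * u) * K (s z * expR u)).
  move=> mK; apply: measurable_funM; first exact: measurable_expRM.
  apply: (measurableT_comp mK); apply: measurable_funM => //.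
rewrite (@ge0_integral_affine _ (-1) (x + ln (s z))) ?oppr_eq0 ?oner_eq0//; last 2 first.
- apply/measurable_EFinP; apply: measurable_funM; last exact: L1_meas g1.
  exact: (measurable_reflect x (meas _ measurable_step)).
- move=> w; rewrite lee_fin.
  exact: mulr_ge0 (mulr_ge0 (expR_ge0 _) (step_ge0 _)) (g_ge0 w).
rewrite normrN1 mul1e; apply: eq_integral => v _; congr EFin.
have -> : x - (-1 * v + (x + ln (s z))) = v - ln (s z) by ring.
have -> : -1 * v + (x + ln (s z)) = (x - v) + ln (s z) by ring.
have -> : expR (v - ln (s z)) = expR v / s z by rewrite expRB lnK.
have gE : expR (x - v + ln (s z)) = expR (x - v) * s z by rewrite expRD lnK.
rewrite /g gE.
have -> : s z * (expR v / s z) = expR v by rewrite mulrCA divff ?mulr1 ?gt_eqF.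
have -> : step (expR v) = \1_`]-oo, 0[ v.
  rewrite /step !indicE; congr (_%:R); congr nat_of_bool.
  by apply/idP/idP; rewrite !inE /= !in_itv /= expR_lt1.
rewrite /exp_ray.
have -> : expR (a * (x - v + ln (s z))) = expR (a * (x - v)) * expR (a * ln (s z)).
  by rewrite -expRD; congr expR; ring.
have -> : expR (a * (v - ln (s z))) = expR (a * v) / expR (a * ln (s z)).
  by rewrite -expRB; congr expR; ring.
rewrite [expR (x - v) * s z]mulrC; field.
by rewrite gt_eqF ?expR_gt0.
Qed.

Let conv_fg x : conv f g x = c * conv N exp_ray x.
Proof.
have k1 := L1_exp_ray.
apply: EFin_inj.
rewrite [in LHS]/conv (L1_EFin (L1_conv x bf g1)).
have h := L1_conv x bN k1; rewrite /conv -(RintZl _ h) (L1_EFin (L1_Z c h)).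
pose Phi (p : measurableTypeR R * T) : \bar R :=
  (expR (a * (x - p.1)) * step (s p.2 * expR (x - p.1)) * g p.1)%:E.
pose Psi (p : measurableTypeR R * T) : \bar R :=
  (c * (expR (a * (x - p.1)) * H (s p.2 * expR (x - p.1)) * exp_ray p.1))%:E.
transitivity (\int[mu]_w \int[m]_z Phi (w, z))%E.
  apply: eq_integral => w _.
  rewrite /f /mellin_conv mulrC -RintZl; last exact: L1_mellin measurable_step step01 _.
  rewrite L1_EFin; last by apply: L1_Z; exact: L1_mellin measurable_step step01 _.
  by apply: eq_integral => z _; rewrite /Phi /= mulrC.
transitivity (\int[mu]_v \int[m]_z Psi (v, z))%E; last first.
  apply: eq_integral => v _.
  rewrite /N /mellin_conv [_ * exp_ray v]mulrC mulrA -RintZl; last exact: L1_mellin mH HB _.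
  rewrite L1_EFin; last by apply: L1_Z; exact: L1_mellin mH HB _.
  by apply: eq_integral => z _; rewrite /Psi /=; congr EFin; ring.
have mint (K : R -> R) : measurable_fun setT K ->
    measurable_fun [set: measurableTypeR R * T]
      (fun p => expR (a * (x - p.1)) * K (s p.2 * expR (x - p.1))).
  move=> mK.
  have mr : measurable_fun setT (fun p : measurableTypeR R * T =>
      ((x - p.1, p.2) : measurableTypeR R * T)).
    by apply: measurable_fun_pair => //=; exact: measurable_funB.
  exact (measurableT_comp (measurable_mellin_integrand mK) mr).
have mPhi : measurable_fun setT Phi.
  apply/measurable_EFinP; apply: measurable_funM; first exact: mint measurable_step.
  by apply: measurableT_comp (L1_meas g1) measurable_fst.
have mPsi : measurable_fun setT Psi.
  apply/measurable_EFinP; apply: measurable_funM => //.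
  apply: measurable_funM; first exact: mint mH.
  by apply: measurableT_comp measurable_exp_ray measurable_fst.
have Phi0 p : (0 <= Phi p)%E.
  rewrite lee_fin.
  exact: mulr_ge0 (mulr_ge0 (expR_ge0 _) (step_ge0 _)) (g_ge0 p.1).
have Psi0 p : (0 <= Psi p)%E.
  have /andP[h0 _] := HB (s p.2 * expR (x - p.1)).
  rewrite lee_fin; apply: mulr_ge0; first exact: ltW.
  exact: mulr_ge0 (mulr_ge0 (expR_ge0 _) h0) (exp_ray_ge0 _).
rewrite (fubini_tonelli (m1 := mu) (m2 := m) Phi mPhi Phi0).
rewrite (fubini_tonelli (m1 := mu) (m2 := m) Psi mPsi Psi0).
apply: ae_eq_integral => //.
- exact: (measurable_fun_fubini_tonelli_G (m1 := mu) Phi mPhi Phi0).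
- exact: (measurable_fun_fubini_tonelli_G (m1 := mu) Psi mPsi Psi0).
(* After Tonelli on both sides the inner integrals agree off this set, which is null by [m_s0]. *)
exists [set z | s z = 0]; split => //.
  by rewrite -[X in measurable X]setTI; exact: (ms measurableT (measurable_set1 (0 : R))).
move=> z /=; apply: contra_notP => /eqP sz _; apply: inner.
by rewrite lt_neqAle eq_sym sz s_ge0.
Qed.

Theorem radial_tauberian :
  expR (a * x) * fine (m [set z | s z < expR (- x)]) @[x --> +oo] --> c * L / a.
Proof.
under eq_fun do rewrite -mellin_step_eq.
set l := c * L / a.
have bfl : bmeas (fun x => f x - l).
  apply: bmeasD => //; split; first exact: measurable_cst.
  by exists `|l| => _; rewrite normrN.
(* The mass of [exp_ray] is 1 / a, so convolution with it turns the limit [L] into [L / a]. *)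
have convNk : conv N exp_ray x @[x --> +oo] --> L / a.
  have h0 : conv (fun x => N x - L) exp_ray x @[x --> +oo] --> 0.
    apply: conv_cvg0; [|exact: L1_exp_ray|].
      apply: bmeasD => //; split; first exact: measurable_cst.
      by exists `|L| => _; rewrite normrN.
    by rewrite -(subrr L); apply: cvgB => //; exact: cvg_cst.
  rewrite -[X in _ --> X]add0r (_ : conv N _ =
      fun x => conv (fun x => N x - L) exp_ray x + L / a).
    by apply: cvgD => //; exact: cvg_cst.
  apply/funext => x; have h1 := L1_conv x bN L1_exp_ray.
  have h2 := L1_Z L L1_exp_ray.
  have -> : L / a = \int[mu]_v (L * exp_ray v).
    by rewrite (RintZl _ L1_exp_ray) /Rintegral integral_exp_rayE.
  rewrite /conv; under [X in _ = X + _]eq_Rintegral do rewrite mulrBl.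
  by rewrite (RintB h1 h2) subrK.
have convfl : conv (fun x => f x - l) g x @[x --> +oo] --> 0.
  rewrite (_ : conv _ g = fun x => c * conv N exp_ray x - l).
    have -> : 0 = c * (L / a) - l by rewrite /l mulrA subrr.
    exact: (cvgB (cvgM (cvg_cst c) convNk) (cvg_cst l)).
  apply/funext => x; rewrite -conv_fg.
  have h1 := L1_conv x bf g1; have h2 := L1_Z l g1.
  rewrite /conv; under eq_Rintegral do rewrite mulrBl.
  by rewrite (RintB h1 h2) (RintZl _ g1) g_mass mulr1.
apply: (slow_decrease_tauberian bf _ (ltW a0) f_slow).
  by move=> x; exact: mellin_conv_ge0 step01 _.
by move=> e e0; exact: (wiener_fejer bfl g1 g_hat convfl).
Qed.

End tauberian.

End radial_tauberian.

(** * The radial profile of phi on the logarithmic scale *)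

Section radial_profile.
Context (R : realType) (n : nat).
Notation mu := (@lebesgue_measure R).
Variable phi : 'rV[R]_n -> R.
Hypotheses (n0 : (0 < n)%N) (phi_gt0 : forall x, 0 < phi x).
Hypotheses (phi_radial : radial phi) (phi_decr : radially_decreasing phi).
Hypothesis phi_meas : measurable_fun setT phi.
Hypothesis phi_int : (\int[lebesgue_rV n]_x (phi x)%:E = 1)%E.

(** Positive dimension provides the coordinate axis along which [phi] is sampled. *)
Definition profile (u : R) : R := phi (u *: delta_mx ord0 (Ordinal n0)).

Let enorm_delta (u : R) : enorm (u *: delta_mx ord0 (Ordinal n0) : 'rV[R]_n) = `|u|.
Proof.
rewrite enormZ /enorm (bigD1 (Ordinal n0))//= mxE !eqxx/= expr1n big1 ?addr0.
  by rewrite sqrtr1 mulr1.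
by move=> i ne; rewrite mxE (negbTE ne) andbF expr0n.
Qed.

Lemma profile_enorm x : profile (enorm x) = phi x.
Proof. by apply: phi_radial; rewrite enorm_delta ger0_norm ?enorm_ge0. Qed.

Lemma measurable_profile : measurable_fun setT profile.
Proof.
apply: (measurableT_comp phi_meas); apply: measurable_fun_row => i.
by under eq_fun do rewrite mxE; exact: measurable_funM.
Qed.

Lemma profile_le u : 0 <= profile u <= phi 0.
Proof.
rewrite /profile ltW//=; apply: phi_decr.
by rewrite enorm0 enorm_ge0.
Qed.

Lemma profile_decr u v : 0 <= u -> u <= v -> profile v <= profile u.
Proof.
move=> u0 uv; apply: phi_decr; rewrite !enorm_delta !ger0_norm//.
exact: le_trans uv.
Qed.

Lemma ln_enorm_ae (x : 'rV[R]_n) : x != 0 -> profile (expR (ln (enorm x))) = phi x.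
Proof. by move=> x0; rewrite lnK ?profile_enorm// posrE enorm_gt0. Qed.

Let mrho : measurable_fun setT (fun x : 'rV[R]_n => ln (enorm x) : R).
Proof.
by apply: (measurableT_comp (@measurable_ln R)); exact: measurable_enorm.
Qed.

Let measurable_profile_exp : measurable_fun setT (fun w : R => profile (expR w)).
Proof. exact: (measurableT_comp measurable_profile (@measurable_expR R)). Qed.

Definition log_profile (w : R) : R := profile (expR w) * polar_density n w.

Lemma log_profile_ge0 w : 0 <= log_profile w.
Proof.
by apply: mulr_ge0; [have /andP[] := profile_le (expR w)|exact: polar_density_ge0].
Qed.

Lemma measurable_log_profile : measurable_fun setT log_profile.
Proof.
apply: measurable_funM; first exact: measurable_profile_exp.
exact: measurable_polar_density.
Qed.

Lemma integral_log_profile : (\int[mu]_w (log_profile w)%:E = 1)%E.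
Proof.
rewrite -phi_int.
have mE : measurable_fun setT (fun w : R => (profile (expR w))%:E).
  by apply/measurable_EFinP; exact: measurable_profile_exp.
have pE (w : R) : (0 <= (profile (expR w))%:E)%E.
  by rewrite lee_fin; have /andP[] := profile_le (expR w).
have := ge0_integral_polar n0 mE pE.
under [X in _ = X -> _]eq_integral do rewrite -EFinM.
move=> <-; apply: ae_eq_integral => //.
- apply/measurable_EFinP.
  exact: (measurableT_comp measurable_profile_exp mrho).
- exact/measurable_EFinP.
- exists [set 0]; split; [exact: measurable_set1_rV|exact: lebesgue_rV_set1|].
  by move=> x /=; apply: contra_notP => /eqP x0 _; rewrite ln_enorm_ae.
Qed.

Lemma L1_log_profile : L1 mu log_profile.
Proof.
apply/integrableP; split; first by apply/measurable_EFinP; exact: measurable_log_profile.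
under eq_integral do rewrite /comp gee0_abs ?lee_fin ?log_profile_ge0//.
by rewrite integral_log_profile ltry.
Qed.

Lemma Rintegral_radial_phi (F : R -> R) : measurable_fun setT F ->
  \int[lebesgue_rV n]_x (phi x * F (ln (enorm x))) =
  \int[mu]_w (F w * log_profile w).
Proof.
move=> mF.
have mH : measurable_fun setT (fun w : R => profile (expR w) * F w).
  by apply: measurable_funM.
have := Rintegral_polar n0 mH.
under [X in _ = X -> _]eq_Rintegral do rewrite mulrAC mulrC.
move=> <-; congr fine; apply: ae_eq_integral => //.
- apply/measurable_EFinP; apply: measurable_funM => //.
  exact: (measurableT_comp mF mrho).
- apply/measurable_EFinP.
  exact: (measurableT_comp mH mrho).
- exists [set 0]; split; [exact: measurable_set1_rV|exact: lebesgue_rV_set1|].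
  by move=> x /=; apply: contra_notP => /eqP x0 _; rewrite ln_enorm_ae.
Qed.

(** As |x|^(iy) has parts cos (y ln |x|) and sin (y ln |x|), polar coordinates turn the two parts of
    the integral into the cosine and sine transforms of [log_profile], which therefore cannot both
    vanish. *)
Lemma mellin_transform_neq0 (y : R) :
  complex_integral (lebesgue_rV n)
    (fun x => ((phi x)%:C * cpower (enorm x) (0 +i* y))%C) <> 0 ->
  0 < (\int[mu]_w (cos (y * w) * log_profile w)) ^+ 2
      + (\int[mu]_w (sin (y * w) * log_profile w)) ^+ 2.
Proof.
move=> h; rewrite lt_neqAle addr_ge0 ?sqr_ge0// andbT eq_sym.
apply/negP; rewrite paddr_eq0 ?sqr_ge0// !sqrf_eq0 => /andP[/eqP c0 /eqP s0].
apply: h; rewrite /complex_integral; apply/eqP; rewrite eq_complex /=.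
have mc : measurable_fun setT (fun w : R => cos (y * w)).
  by under eq_fun do rewrite mulrC; exact: measurable_cosM.
have ms : measurable_fun setT (fun w : R => sin (y * w)).
  by under eq_fun do rewrite mulrC; exact: measurable_sinM.
apply/andP; split.
- apply/eqP; apply: (etrans _ c0); rewrite -(Rintegral_radial_phi mc).
  apply: eq_Rintegral => x _.
  rewrite /cpower /expC /=.
  rewrite !(mul0r, mulr0, addr0, add0r, oppr0) expR0.
  by rewrite mul1r [y * _]mulrC.
- apply/eqP; apply: (etrans _ s0); rewrite -(Rintegral_radial_phi ms).
  apply: eq_Rintegral => x _.
  rewrite /cpower /expC /=.
  rewrite !(mul0r, mulr0, addr0, add0r, oppr0) expR0.
  by rewrite mul1r [y * _]mulrC.
Qed.

(* Monotonicity of the profile makes [log_profile] at most [expR n] times its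
   average over the preceding unit interval. *)
Lemma log_profile_cvg0 : log_profile x @[x --> +oo] --> 0.
Proof.
have bI : bmeas (\1_`[0, 1] : R -> R).
  split; first by apply: measurable_indic; exact: measurable_itv.
  by exists 1 => x; rewrite indicE; case: (_ \in _); rewrite ?normr1 ?normr0.
have I0 : (\1_`[0, 1] : R -> R) x @[x --> +oo] --> (0 : R).
  apply: cvg_near_cst; apply: filterS (nbhs_pinfty_gt (num_real (1 : R))).
  by move=> x x1; rewrite indicE memNset//= in_itv /= => /andP[_]; rewrite leNgt x1.
have h := conv_cvg0 bI L1_log_profile I0.
have I1 : L1 mu (\1_`[0, 1]) by exact: integrable_indic_itv.
have I1w w := L1_reflect w I1.
have Imass w : \int[mu]_v \1_`[0, 1] (w - v) = 1.
  rewrite Rintegral_reflect// /Rintegral integral_indic//= setIT.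
  by rewrite lebesgue_measure_itv /= lte_fin ltr01 oppr0 addr0.
have bound w : `|log_profile w| <= expR n%:R * conv \1_`[0, 1] log_profile w.
  rewrite ger0_norm ?log_profile_ge0// -[leLHS]mulr1.
  rewrite -[X in _ * X <= _](Imass w).
  have c1 := L1_conv w bI L1_log_profile.
  rewrite -(RintZl _ (I1w w)) /conv -(RintZl _ c1).
  apply: le_Rintegral => //; [exact: L1_Z (I1w w)|exact: L1_Z c1|].
  move=> v _; rewrite indicE; case: (boolP (_ \in _)) => [|_]; last first.
    by rewrite !(mulr0, mul0r).
  rewrite inE /= in_itv /= => /andP[v0 v1].
  rewrite mulr1 mul1r /log_profile [leRHS]mulrCA.
  have /andP[p0 _] := profile_le (expR w).
  apply: ler_pM => //; first exact: polar_density_ge0.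
    by apply: profile_decr; rewrite ?expR_ge0// ler_expR; lra.
  rewrite /polar_density [leRHS]mulrCA ler_wpM2l//.
    by rewrite mulr_ge0// ltW// unit_ball_volume_gt0.
  rewrite -expRD ler_expR -[X in X + _]mulr1 -mulrDr ler_wpM2l//; lra.
apply/cvgr0Pnorm_le => e e0.
have e1 : 0 < e / expR n%:R by rewrite divr_gt0 ?expR_gt0.
move/cvgr0Pnorm_le : h => /(_ _ e1); apply: filterS => w hw.
rewrite (le_trans (bound w))// mulrC -ler_pdivlMr ?expR_gt0//.
exact: le_trans (ler_norm _) hw.
Qed.

End radial_profile.

Lemma expRN_cvg_at_right (R : realType) : expR (- x) @[x --> +oo] --> (0 : R)^'+.
Proof.
move=> P [e /= e0 eP]; exists (- ln e); split; first exact: num_real.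
move=> x ex; apply: eP; last exact: expR_gt0.
rewrite /ball /= sub0r normrN ger0_norm ?expR_ge0//.
by rewrite -[ltRHS]lnK ?posrE// ltr_expR; lra.
Qed.

Lemma cvg_at_right_expRN (R : realType) (f : R -> R) (l : R) :
  f x @[x --> +oo] --> l -> f (- ln r) @[r --> 0^'+] --> l.
Proof.
move=> fl; apply: cvg_comp fl => P [M [_ MP]].
apply: (filterS2 _ _ (@nbhs_right_gt _ (0 : R)) (nbhs_right_lt (expR_gt0 (- M)))).
move=> r r0; rewrite -{1}[r]lnK ?posrE// ltr_expR => rM.
by apply: MP; lra.
Qed.

(** * Symmetric derivatives *)

Section localization.
Context (R : realType) (n : nat).
Variable phi : 'rV[R]_n -> R.
Hypotheses (n0 : (0 < n)%N) (phi_gt0 : forall x, 0 < phi x).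
Hypotheses (phi_radial : radial phi) (phi_decr : radially_decreasing phi).
Hypothesis phi_meas : measurable_fun setT phi.
Hypothesis phi_int : (\int[lebesgue_rV n]_x (phi x)%:E = 1)%E.
Hypothesis phi_sup : (ereal_sup [set (dilate phi t x / phi x)%:E |
  t in [set t : R | (0 < t < 1)%R] & x in [set x | (1 < enorm x)%R]] < +oo)%E.
Variables (mu : {measure set 'rV[R]_n -> \bar R}) (x0 : 'rV[R]_n) (L : R).
Hypothesis lim : convolution mu (dilate phi t) x0 @[t --> 0^'+] --> L%:E.

Let H := profile phi n0.
Let a : R := n%:R.
Let s (z : 'rV[R]_n) := enorm (z - x0).
Let F x z := expR (a * x) * H (s z * expR x).

Let HB u : 0 <= H u <= phi 0 := profile_le n0 phi_gt0 phi_decr u.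

Let dilate_exp x y : dilate phi (expR (- x)) y =
  expR (a * x) * H (enorm y * expR x).
Proof.
rewrite /dilate /H expRN invrK -exprVn invrK -expRM_natl; congr (_ * _).
by rewrite -(profile_enorm n0 phi_radial) enormZ ger0_norm ?expR_ge0// mulrC.
Qed.

Let convolutionE x : convolution mu (dilate phi (expR (- x))) x0 =
  (\int[mu]_z (F x z)%:E)%E.
Proof.
apply: eq_integral => z _.
by rewrite dilate_exp /F /s -[z - x0]opprB enormN.
Qed.

Let F_lim : (\int[mu]_z (F x z)%:E)%E @[x --> +oo] --> L%:E.
Proof.
under eq_fun do rewrite -convolutionE.
exact (cvg_comp (fun x : R => expR (- x)) (fun t => convolution mu (dilate phi t) x0)
  (@expRN_cvg_at_right R) lim).
Qed.

Let F_ge0 x z : 0 <= F x z.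
Proof. by rewrite mulr_ge0 ?expR_ge0//; have /andP[] := HB (s z * expR x). Qed.

Let mF x : measurable_fun setT (F x).
Proof.
apply: measurable_funM => //; apply: (measurableT_comp (measurable_profile n0 phi_meas)).
by apply: measurable_funM => //; exact: measurable_dist.
Qed.

(** Hypothesis (2) with t = e^(-x). The absolute value in the witness makes the constant nonnegative
    at once. *)
Let phi_bound : exists2 C, 0 <= C & forall x y, 0 < x -> 1 < enorm y ->
  expR (a * x) * H (enorm y * expR x) <= C * phi y.
Proof.
have supS := phi_sup; set S := (X in ereal_sup X) in supS.
exists `|fine (ereal_sup S)| => // x y xgt0 y1.
rewrite -dilate_exp -ler_pdivrMr//.
have Sy : S (dilate phi (expR (- x)) y / phi y)%:E.
  by exists (expR (- x)); rewrite /= ?expR_gt0 ?expR_lt1 ?oppr_lt0//; exists y.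
have h := ereal_sup_ubound Sy.
apply: (le_trans _ (ler_norm _)); rewrite -lee_fin fineK//.
rewrite fin_numE; apply/andP; split; last by rewrite -ltey.
by apply: contraTneq h => ->; rewrite leeNy_eq.
Qed.

(** The measure is [mu] restricted to a closed ball. Outside it the integrand at scale [x] is
    dominated by a multiple of the one at scale [x1], which is integrable, and tends to 0 pointwise
    by [log_profile_cvg0]; so the far part is negligible. *)
Lemma localization : exists (x1 : R) (m : {finite_measure set 'rV[R]_n -> \bar R}),
  (forall A, measurable A -> A `<=` [set z | s z <= expR (- x1)] -> m A = mu A) /\
  mellin_conv m s a H x @[x --> +oo] --> L.
Proof.
have /fine_cvgP[[X [_ Fin]] F_lim'] := F_lim.
(* The integral is finite at every scale beyond [X]. The one at [x1] supplies both the majorant of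
   the far part and the finiteness of [mu K]. *)
pose x1 := X + 1; have x1X : X < x1 by rewrite ltrDl.
have L1F x : X < x -> L1 mu (F x).
  move=> Xx; apply/integrableP; split; first exact/measurable_EFinP.
  under eq_integral do rewrite /comp gee0_abs ?lee_fin//.
  by rewrite ltey_eq Fin.
pose K := [set z | s z <= expR (- x1)].
have mK : measurable K.
  rewrite (_ : K = s @^-1` `]-oo, expR (- x1)]); last first.
    by apply/seteqP; split => z; rewrite /K /= in_itv.
  by rewrite -[X in measurable X]setTI; exact: measurable_dist.
(* A lower bound for [F x1] on [K], where the argument of [H] is at most 1. *)
pose c1 := expR (a * x1) * H 1.
have H1 : 0 < H 1 by exact: phi_gt0.
have c10 : 0 < c1 by rewrite mulr_gt0// expR_gt0.
have muK : (mu K < +oo)%E.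
  have h : (c1%:E * mu K <= \int[mu]_z (F x1 z)%:E)%E.
    have mFE D : measurable_fun D (EFin \o F x1).
      by apply: measurable_funTS; exact/measurable_EFinP.
    apply: (@le_trans _ _ (\int[mu]_(z in K) (F x1 z)%:E)%E); last first.
      by apply: ge0_subset_integral => // z _; rewrite lee_fin.
    rewrite -integral_cst//; apply: ge0_le_integral => //.
      by move=> z _; rewrite lee_fin ltW.
    move=> z; rewrite /K /= => sz; rewrite lee_fin.
    apply: ler_wpM2l; first exact: expR_ge0.
    apply: profile_decr => //; first by rewrite mulr_ge0 ?expR_ge0 ?enorm_ge0.
    by rewrite -ler_pdivlMr ?expR_gt0// div1r -expRN.
  have fin1 := Fin _ x1X; rewrite ltey; apply/eqP => K_oo; move: h.
  rewrite K_oo mulry gtr0_sg// mul1e leye_eq => /eqP h1.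
  by move: fin1; rewrite h1.
pose m : {finite_measure set 'rV[R]_n -> \bar R} := mfrestr mK muK.
exists x1, m; split.
  by move=> A mA AK; rewrite /m /= /mfrestr /mrestr setIidl.
have m_indic : measurable_fun setT (\1_K : 'rV[R]_n -> R) by exact: measurable_indic.
have indic_ge0 z : 0 <= \1_K z :> R by [].
have mellinE x : mellin_conv m s a H x = \int[mu]_z (\1_K z * F x z).
  rewrite /mellin_conv /Rintegral; congr fine.
  rewrite (eq_measure_integral (density_measure mu m_indic indic_ge0)); last first.
    move=> A mA _; transitivity (\int[mu]_(z in A) (\1_K z)%:E)%E; last by [].
    by rewrite integral_indic// setIC.
  have mFE : measurable_fun setT (fun z => (F x z)%:E) by exact/measurable_EFinP.
  rewrite (ge0_integral_density mu m_indic indic_ge0 mFE); last first.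
    by move=> z; rewrite lee_fin.
  by apply: eq_integral => z _; rewrite -EFinM mulrC.
have mcK : measurable_fun setT (fun z : 'rV[R]_n => 1 - \1_K z : R).
  exact: measurable_funB.
have cK1 z : `|1 - \1_K z| <= 1 :> R.
  by rewrite indicE; case: (_ \in _); rewrite ?subrr ?subr0 ?normr0 ?normr1.
have K1 z : `|\1_K z| <= 1 :> R.
  by rewrite indicE; case: (_ \in _); rewrite ?normr0 ?normr1.
pose far x := \int[mu]_z ((1 - \1_K z) * F x z).
have split_eq x : X < x ->
    fine (\int[mu]_z (F x z)%:E)%E = mellin_conv m s a H x + far x.
  move=> Xx; have l1 := L1_bounded_mul m_indic K1 (L1F x Xx).
  have l2 := L1_bounded_mul mcK cK1 (L1F x Xx).
  rewrite mellinE /far -(RintD l1 l2); apply: eq_Rintegral => z _.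
  by rewrite -mulrDl addrC subrK mul1r.
have [C C0 hC] := phi_bound.
have F_far x z : x1 < x -> ~ K z -> F x z <= C * F x1 z.
  move=> x1x /negP; rewrite /K /= -ltNge => sz.
  (* Rescaling by [x1] sends the complement of [K] to vectors of norm above 1, where [phi_bound]
     applies with scale [x - x1]. *)
  pose y := expR x1 *: (z - x0).
  have yE : enorm y = s z * expR x1 by rewrite enormZ ger0_norm ?expR_ge0// mulrC.
  have y1 : 1 < enorm y.
    by rewrite yE -ltr_pdivrMr ?expR_gt0// div1r -expRN.
  have xx1 : 0 < x - x1 by rewrite subr_gt0.
  have := hC _ _ xx1 y1.
  rewrite -(profile_enorm n0 phi_radial) yE -/H -mulrA -expRD.
  have -> : x1 + (x - x1) = x by ring.
  move=> h; rewrite /F; have -> : a * x = a * x1 + a * (x - x1) by ring.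
  rewrite expRD -mulrA [leRHS]mulrCA; apply: ler_wpM2l => //; exact: expR_ge0.
have far0 : far x @[x --> +oo] --> 0.
  (* The cut-off factor makes the domination hold for every term of a sequence, not just
     eventually. *)
  pose far' x := \int[mu]_z ((x1 < x)%R%:R * ((1 - \1_K z) * F x z)).
  suff far'0 : far' x @[x --> +oo] --> 0.
    apply: cvg_trans far'0; apply: near_eq_cvg.
    apply: filterS (nbhs_pinfty_gt (num_real x1)) => x x1x.
    by apply: eq_Rintegral => z _; rewrite x1x mul1r.
  apply/cvg_pinftyP => u uoo; rewrite -[X in _ --> X](Rint0 mu).
  apply: (@dct_seq _ _ _ mu (fun k z => (x1 < u k)%R%:R * ((1 - \1_K z) * F (u k) z))
    (cst 0) (fun z => C * F x1 z)).
  - by move=> k; apply: measurable_funM => //; exact: measurable_funM.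
  - exact: (@measurable_cst _ _ _ _ setT (0 : R)).
  - exact: L1_Z (L1F _ x1X).
  - move=> k z; have CF : 0 <= C * F x1 z by rewrite mulr_ge0.
    have [x1u|_] := ltP x1 (u k); last by rewrite mul0r normr0.
    rewrite mul1r indicE; have [zK|zK] := boolP (z \in K).
      by rewrite subrr mul0r normr0.
    rewrite subr0 mul1r ger0_norm//; apply: F_far => //.
    by move=> /mem_set; apply/negP.
  move=> z; have [zK|zK] := boolP (z \in K).
    apply: cvg_near_cst; apply: nearW => k.
    by rewrite indicE zK subrr mul0r mulr0.
  have nK : ~ K z by move=> /mem_set; apply/negP.
  have s0 : 0 < s z.
    apply: lt_trans (expR_gt0 (- x1)) _.
    by move/negP : nK; rewrite /K /= -ltNge.
  pose c2 := (n%:R * unit_ball_volume R n * expR (a * ln (s z)))^-1.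
  (* For fixed [z] away from x0, the integrand is a constant multiple of a translate of
     [log_profile]. *)
  have FE x : F x z = c2 * log_profile phi n0 (x + ln (s z)).
    have ub := unit_ball_volume_gt0 R n; have nR : 0 < n%:R :> R by rewrite ltr0n.
    rewrite /F /c2 /log_profile /polar_density expRD lnK ?posrE// -/H.
    rewrite [expR x * _]mulrC mulrDr expRD -/a; field.
    by rewrite !gt_eqF ?expR_gt0.
  have Fu0 : F (u k) z @[k --> \oo] --> 0.
    rewrite (_ : (fun k => _) = fun k => c2 * log_profile phi n0 (u k + ln (s z))); last first.
      by apply/funext => k; exact: FE.
    rewrite -[X in _ --> X](mulr0 c2).
    apply: cvgM; first exact: cvg_cst.
    have lp0 := log_profile_cvg0 n0 phi_gt0 phi_radial phi_decr phi_meas phi_int.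
    move/cvg_pinftyP : lp0; apply.
    apply/cvgryPge => A; move/cvgryPge : uoo => /(_ (A - ln (s z))).
    by apply: filterS => k; rewrite lerBlDr.
  apply/cvgr0Pnorm_le => e e0; move/cvgr0Pnorm_le : Fu0 => /(_ _ e0).
  apply: filterS => k; apply: le_trans.
  rewrite !normrM mulrA ler_piMl// mulr_ile1//.
  by case: (_ < _)%R; rewrite ?normr1 ?normr0.
rewrite -(subr0 L); apply: cvg_trans (cvgB F_lim' far0).
apply: near_eq_cvg; apply: filterS (nbhs_pinfty_gt (num_real X)) => x Xx.
by rewrite -[RHS](addrK (far x)) -split_eq.
Qed.

End localization.

Local Open Scope complex_scope.

Theorem theorem2p10 (R : realType) (n : nat) (n_ge1 : (1 <= n)%N)
    (phi : 'rV[R]_n -> R) (phi_gt0 : forall x, 0 < phi x)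
    (phi_radial : radial phi) (phi_decr : radially_decreasing phi)
    (phi_meas : measurable_fun setT phi)
    (phi_int : (\int[lebesgue_rV n]_x (phi x)%:E = 1)%E)
    (phi_sup : (ereal_sup [set (dilate phi t x / phi x)%:E |
        t in [set t : R | (0 < t < 1)%R] & x in [set x | (1 < enorm x)%R]]
      < +oo)%E)
    (phi_mellin : forall y : R,
      complex_integral (lebesgue_rV n)
        (fun x => (phi x)%:C * cpower (enorm x) (0 +i* y)) <> 0)
    (mu : {measure set 'rV[R]_n -> \bar R}) (mu_radon : radon mu)
    (mu_phi : exists2 t0 : R, 0 < t0 &
      convolution mu (dilate phi t0) 0 \is a fin_num)
    (x0 : 'rV[R]_n) (L : R) (L_ge0 : 0 <= L) :
  convolution mu (dilate phi t) x0 @[t --> 0^'+] --> L%:E ->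
  has_symmetric_derivative mu x0 L%:E.
Proof.
move=> lim.
have [x1 [m [m_mu NL]]] := localization n_ge1 phi_gt0 phi_radial phi_decr
  phi_meas phi_int phi_sup lim.
have n0 : 0 < n%:R :> R by rewrite ltr0n.
have V0 := unit_ball_volume_gt0 R n; set V := unit_ball_volume R n in V0.
have mass : \int[@lebesgue_measure R]_w log_profile phi n_ge1 w = 1.
  by rewrite /Rintegral integral_log_profile.
have g1 := L1_log_profile n_ge1 phi_gt0 phi_radial phi_decr phi_meas phi_int.
have g_hat y := mellin_transform_neq0 n_ge1 phi_radial phi_meas (phi_mellin y).
have ms : measurable_fun setT (fun z : 'rV[R]_n => enorm (z - x0)).
  exact (measurable_dist x0).
have := radial_tauberian ms (fun z => enorm_ge0 _) n0
  (measurable_profile n_ge1 phi_meas) (profile_le n_ge1 phi_gt0 phi_decr)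
  (profile_decr n_ge1 phi_decr) (phi_gt0 _) (mulr_gt0 n0 V0) g1 mass g_hat NL.
(* The constant c / a of [radial_tauberian] is n V / n; the factor V is divided out below to get the
   ratio of measures. *)
have -> : n%:R * V * L / n%:R = V * L by field; rewrite gt_eqF.
move=> /cvg_at_right_expRN h.
have hV := cvgM h (cvg_cst V^-1).
have {hV} h' : fine (m (eball x0 r)) / (V * r ^+ n) @[r --> 0^'+] --> L.
  rewrite (_ : L = V * L * V^-1); last by rewrite mulrAC divff ?mul1r// gt_eqF.
  apply: (cvg_trans _ (hV _ _)); apply: near_eq_cvg.
  apply: filterS (@nbhs_right_gt _ (0 : R)) => r r0.
  rewrite /= opprK lnK ?posrE// expRM_natl expRN lnK ?posrE// exprVn invfM.
  by rewrite mulrAC [RHS]mulrC [V^-1 * _]mulrC.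
have {}h' : (fine (m (eball x0 r)) / (V * r ^+ n))%:E @[r --> 0^'+] --> L%:E.
  by apply/fine_cvgP; split; [exact: nearW|exact h'].
apply: cvg_trans h'; apply: near_eq_cvg.
apply: (filterS2 _ _ (@nbhs_right_gt _ (0 : R)) (nbhs_right_lt (expR_gt0 (- x1)))).
move=> r r0 rx1; have mB := measurable_eball x0 r.
(* Radii below e^(-x1) keep the ball inside the set where [m] and [mu] agree. *)
have mE : m (eball x0 r) = mu (eball x0 r).
  by apply: m_mu => // z /= zr; apply: ltW; exact: lt_trans zr rx1.
rewrite lebesgue_rV_eball// -mE EFinM inver gt_eqF ?mulr_gt0 ?exprn_gt0//.
by rewrite fineK// fin_num_measure.
Qed.
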